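(* Let $k$ be a commutative ring and $\mathsf H$ a cocommutative Hopf algebra over $k$ with antipode $S$. Then the bar resolution $E(\mathsf H)$ is a cyclic $\mathsf H$-module with cyclic operator $t:=\beta\lambda\alpha$, and the bar complex $\mathrm B(\mathsf H)=k\otimes_{\mathsf H}E(\mathsf H)$ is a cyclic $k$-module. The cyclic operator $t$ on $E(\mathsf H)$ is given by $t(h)=h$ in degree $0$, $t(h_0\otimes h_1)=-h_0h_1^{(0)}\otimes Sh_1^{(1)}$ in degree $1$, and in general in degree $n\ge1$ by $$t(h_0\otimes\dots\otimes h_n)=(-1)^n\,h_0h_1^{(0)}\cdots h_n^{(0)}\otimes S(h_1^{(1)}\cdots h_n^{(1)})\otimes h_1^{(2)}\otimes\dots\otimes h_{n-1}^{(2)}.$$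
   Context: Summationless Sweedler notation: $\Delta(h)=h^{(0)}\otimes h^{(1)}$, iterated coproduct $h^{(0)}\otimes h^{(1)}\otimes h^{(2)}$, etc. $\epsilon$ is the counit. Cyclic modules are in Loday's sense, with signed cyclic operators: $t_n^{n+1}=1$, $d_it_n=-t_{n-1}d_{i-1}$ and $s_it_n=-t_{n+1}s_{i-1}$ for $1\le i\le n$, $d_0t_n=(-1)^nd_n$, $s_0t_n=(-1)^nt_{n+1}^2s_n$. The bar resolution $E(\mathsf H)$ is the simplicial left $\mathsf H$-module $E_n(\mathsf H)=\mathsf H^{\otimes n+1}$ ($\mathsf H$ acts by left multiplication on the first factor) with faces $\mu_i(h_0\otimes\dots\otimes h_n)=h_0\otimes\dots\otimes h_ih_{i+1}\otimes\dots\otimes h_n$ for $i<n$, $\mu_n(h_0\otimes\dots\otimes h_n)=\epsilon(h_n)h_0\otimes\dots\otimes h_{n-1}$, and degeneracies $s_j$ inserting $1$ after $h_j$, $0\le j\le n$. $R(\mathsf H)$ is the simplicial module $R_n(\mathsf H)=\mathsf H^{\otimes n+1}$ whose $i$-th face applies $\epsilon$ to the $i$-th factor and whose $i$-th degeneracy applies $\Delta$ to the $i$-th factor; $\mathsf H$ acts diagonally, $a\cdot(h_0\otimes\dots\otimes h_n)=a^{(0)}h_0\otimes\dots\otimes a^{(n)}h_n$; and $\lambda(h_0\otimes\dots\otimes h_n)=(-1)^nh_n\otimes h_0\otimes\dots\otimes h_{n-1}$. The mutually inverse isomorphisms $\alpha:E_n(\mathsf H)\to R_n(\mathsf H)$ and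 $\beta:R_n(\mathsf H)\to E_n(\mathsf H)$ are $\alpha(h_0\otimes\dots\otimes h_n)=h_0^{(0)}\otimes h_0^{(1)}h_1^{(0)}\otimes\dots\otimes h_0^{(n)}h_1^{(n-1)}\cdots h_{n-1}^{(1)}h_n$ and $\beta(h_0\otimes\dots\otimes h_n)=h_0^{(0)}\otimes(Sh_0^{(1)})h_1^{(0)}\otimes\dots\otimes(Sh_{n-1}^{(1)})h_n$. *)

(* Defs.v *)
From HB Require Import structures.
From mathcomp Require Import all_boot all_algebra.
From mathcomp Require Import boolp.

Set Implicit Arguments.
Unset Strict Implicit.
Unset Printing Implicit Defensive.

Import GRing.Theory.
Local Open Scope ring_scope.
Local Open Scope quotient_scope.

(** [lterm k X] are formal [k]-linear expressions in generators from [X];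
    [lrel R] is the smallest congruence containing [R] whose quotient satisfies
    the module axioms. *)

Inductive lterm (k X : Type) : Type :=
  | LGen of X
  | LZero
  | LAdd of lterm k X & lterm k X
  | LScale of k & lterm k X.
Arguments LGen {k X}.
Arguments LZero {k X}.

HB.instance Definition _ (k X : Type) := gen_eqMixin (lterm k X).
HB.instance Definition _ (k X : Type) := gen_choiceMixin (lterm k X).

Inductive lrel (k : pzRingType) (X : Type)
    (R : lterm k X -> lterm k X -> Prop) : lterm k X -> lterm k X -> Prop :=
  | lrel_base x y : R x y -> lrel R x y
  | lrel_refl x : lrel R x x
  | lrel_sym x y : lrel R x y -> lrel R y x
  | lrel_trans x y z : lrel R x y -> lrel R y z -> lrel R x z
  | lrel_add x x' y y' :
      lrel R x x' -> lrel R y y' -> lrel R (LAdd x y) (LAdd x' y')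
  | lrel_scale c x x' : lrel R x x' -> lrel R (LScale c x) (LScale c x')
  | lrel_addA x y z : lrel R (LAdd x (LAdd y z)) (LAdd (LAdd x y) z)
  | lrel_addC x y : lrel R (LAdd x y) (LAdd y x)
  | lrel_add0 x : lrel R (LAdd LZero x) x
  | lrel_scaleA a b x : lrel R (LScale a (LScale b x)) (LScale (a * b) x)
  | lrel_scale1 x : lrel R (LScale 1 x) x
  | lrel_scale0 x : lrel R (LScale 0 x) LZero
  | lrel_scaleDr a x y :
      lrel R (LScale a (LAdd x y)) (LAdd (LScale a x) (LScale a y))
  | lrel_scaleDl a b x :
      lrel R (LScale (a + b) x) (LAdd (LScale a x) (LScale b x)).

Section PresentedModule.
Variables (k : pzRingType) (X : Type) (R : lterm k X -> lterm k X -> Prop).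

Definition lrelb (x y : lterm k X) : bool := `[< lrel R x y >].

Lemma lrelb_equiv : equiv_class_of lrelb.
Proof.
split=> [x|x y|y x z].
- by apply/asboolP; exact: lrel_refl.
- by apply/asboolP/asboolP => /lrel_sym.
- by move=> /asboolP xy /asboolP yz; apply/asboolP; exact: lrel_trans yz.
Qed.

Canonical lrelb_equiv_rel := EquivRelPack lrelb_equiv.

Definition presented := {eq_quot lrelb}.
HB.instance Definition _ := Choice.on presented.

Definition pcl (x : lterm k X) : presented := \pi_{eq_quot lrelb} x.
Definition prepr (x : presented) : lterm k X := repr (x : {eq_quot lrelb}).

Lemma pclK x : pcl (prepr x) = x.
Proof. exact: reprK. Qed.

Lemma pclW (P : presented -> Prop) : (forall x, P (pcl x)) -> forall x, P x.
Proof. by move=> PP x; rewrite -(pclK x). Qed.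

Definition pgen (x : X) : presented := pcl (LGen x).
Definition padd (x y : presented) : presented := pcl (LAdd (prepr x) (prepr y)).
Definition pscale (c : k) (x : presented) : presented :=
  pcl (LScale c (prepr x)).
Definition popp (x : presented) : presented := pscale (-1) x.

Lemma piP (x y : lterm k X) : lrel R x y <-> pcl x = pcl y.
Proof.
split=> [xy|/eqmodP /asboolP //].
by apply/eqmodP/asboolP.
Qed.

Lemma repr_pi (x : lterm k X) : lrel R (prepr (pcl x)) x.
Proof. by apply/piP; rewrite pclK. Qed.

Lemma pi_add x y : padd (pcl x) (pcl y) = pcl (LAdd x y).
Proof. by apply/piP; apply: lrel_add; exact: repr_pi. Qed.

Lemma pi_scale c x : pscale c (pcl x) = pcl (LScale c x).
Proof. by apply/piP; apply: lrel_scale; exact: repr_pi. Qed.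

Lemma paddA : associative padd.
Proof.
elim/pclW=> x; elim/pclW=> y; elim/pclW=> z.
by rewrite !pi_add; apply/piP; exact: lrel_addA.
Qed.

Lemma paddC : commutative padd.
Proof.
elim/pclW=> x; elim/pclW=> y.
by rewrite !pi_add; apply/piP; exact: lrel_addC.
Qed.

Lemma padd0 : left_id (pcl LZero) padd.
Proof. by elim/pclW=> x; rewrite pi_add; apply/piP; exact: lrel_add0. Qed.

Lemma paddN : left_inverse (pcl LZero) popp padd.
Proof.
elim/pclW=> x; rewrite /popp pi_scale pi_add; apply/piP.
apply: (@lrel_trans _ _ _ _ (LAdd (LScale (-1) x) (LScale 1 x))).
  by apply: lrel_add; [exact: lrel_refl|apply: lrel_sym; exact: lrel_scale1].
apply: lrel_trans (lrel_sym (lrel_scaleDl _ _ _ _)) _.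
by rewrite addNr; exact: lrel_scale0.
Qed.

HB.instance Definition _ :=
  GRing.isZmodule.Build presented paddA paddC padd0 paddN.

Lemma pclD x y : pcl x + pcl y = pcl (LAdd x y).
Proof. exact: pi_add. Qed.

Lemma pscaleA a b x : pscale a (pscale b x) = pscale (a * b) x.
Proof.
by elim/pclW: x => x; rewrite !pi_scale; apply/piP; exact: lrel_scaleA.
Qed.

Lemma pscale1 : left_id 1 pscale.
Proof. by elim/pclW=> x; rewrite pi_scale; apply/piP; exact: lrel_scale1. Qed.

Lemma pscaleDr : right_distributive pscale +%R.
Proof.
move=> a; elim/pclW=> x; elim/pclW=> y.
rewrite pclD !pi_scale pclD; apply/piP.
exact: lrel_scaleDr.
Qed.

Lemma pscaleDl x : {morph pscale^~ x : a b / a + b}.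
Proof.
move=> a b; elim/pclW: x => x.
rewrite !pi_scale pclD; apply/piP.
exact: lrel_scaleDl.
Qed.

HB.instance Definition _ := GRing.Zmodule_isLmodule.Build k presented
  pscaleA pscale1 pscaleDr pscaleDl.

Lemma pclZ c x : c *: pcl x = pcl (LScale c x).
Proof. exact: pi_scale. Qed.

Lemma presented_ind (P : presented -> Prop) :
    (forall x, P (pgen x)) -> P 0 ->
    (forall x y, P x -> P y -> P (x + y)) ->
    (forall c x, P x -> P (c *: x)) ->
  forall x, P x.
Proof.
move=> Pg P0 PD PZ; elim/pclW=> x; elim: x => [x||x IHx y IHy|c x IHx].
- exact: Pg.
- exact: P0.
- by rewrite -pclD; exact: PD.
- by rewrite -pclZ; exact: PZ.
Qed.

Section Lift.
Variable V : lmodType k.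

Fixpoint leval (F : X -> V) (x : lterm k X) : V :=
  match x with
  | LGen x => F x
  | LZero => 0
  | LAdd x y => leval F x + leval F y
  | LScale c x => c *: leval F x
  end.

(** [linext F] is the linear extension of [F]. It is defined for every [F], but it
    is meaningful (see [linext_gen], [linext_linear]) only when [F] is compatible
    with the relations. *)
Definition linext (F : X -> V) (x : presented) : V := leval F (prepr x).

Variable F : X -> V.
Hypothesis F_compat : forall x y, R x y -> leval F x = leval F y.

Lemma leval_lrel x y : lrel R x y -> leval F x = leval F y.
Proof.
elim=> //=.
- by move=> {}x {}y z _ -> _ ->.
- by move=> {}x x' {}y y' _ -> _ ->.
- by move=> c {}x x' _ ->.
- by move=> {}x {}y z; rewrite addrA.
- by move=> {}x {}y; rewrite addrC.
- by move=> {}x; rewrite add0r.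
- by move=> a b {}x; rewrite scalerA.
- by move=> {}x; rewrite scale1r.
- by move=> {}x; rewrite scale0r.
- by move=> a {}x {}y; rewrite scalerDr.
- by move=> a b {}x; rewrite scalerDl.
Qed.

Lemma linext_gen x : linext F (pgen x) = F x.
Proof. exact: (leval_lrel (repr_pi (LGen x))). Qed.

Lemma linext_linear : linear (linext F).
Proof.
move=> c; elim/pclW=> x; elim/pclW=> y.
rewrite pclZ pclD /linext.
by rewrite !(leval_lrel (repr_pi _)).
Qed.

End Lift.
End PresentedModule.

Arguments linext {k X R V} F x.

Definition tset (T : Type) n (h : n.-tuple T) (i : 'I_n) (x : T) : n.-tuple T :=
  [tuple if j == i then x else tnth h j | j < n].

Lemma tnth_tset (T : Type) n (h : n.-tuple T) (i : 'I_n) (x : T) j :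
  tnth (tset h i x) j = if j == i then x else tnth h j.
Proof. exact: tnth_mktuple. Qed.

Inductive tpow_rel (k : comPzRingType) (V : lmodType k) n :
    lterm k (n.-tuple V) -> lterm k (n.-tuple V) -> Prop :=
  | tpow_relD h i x y :
      tpow_rel (LGen (tset h i (x + y)))
               (LAdd (LGen (tset h i x)) (LGen (tset h i y)))
  | tpow_relZ h i c x :
      tpow_rel (LGen (tset h i (c *: x))) (LScale c (LGen (tset h i x))).

(** [tpow V n] is the [n]-fold tensor power of [V] over [k]. *)
Definition tpow (k : comPzRingType) (V : lmodType k) (n : nat) :=
  presented (@tpow_rel k V n).
HB.instance Definition _ (k : comPzRingType) (V : lmodType k) n :=
  GRing.Lmodule.on (tpow V n).

Definition tpure (k : comPzRingType) (V : lmodType k) n (h : n.-tuple V) :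
  tpow V n := pgen (@tpow_rel k V n) h.

Definition multilinear (k : comPzRingType) (V W : lmodType k) n
    (F : n.-tuple V -> W) : Prop :=
  forall h i, linear (fun x => F (tset h i x)).

Section TensorPowerTheory.
Variables (k : comPzRingType) (V W : lmodType k) (n : nat).

Lemma tpure_multilinear : multilinear (@tpure k V n).
Proof.
move=> h i c x y; rewrite pclZ pclD; apply/piP.
apply: lrel_trans (lrel_base (tpow_relD _ _ _ _)) _.
by apply: lrel_add; [exact/lrel_base/tpow_relZ|exact: lrel_refl].
Qed.

Variable F : n.-tuple V -> W.
Hypothesis Fl : multilinear F.

Lemma multilinear_compat x y : tpow_rel x y -> leval F x = leval F y.
Proof.
case=> [h i {}x {}y|h i c {}x] /=.
  by have := Fl h i 1 x y; rewrite !scale1r.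
have F0 : F (tset h i 0) = 0.
  have := Fl h i 1 0 0; rewrite !scale1r addr0.
  by move/(congr1 (fun z => z - F (tset h i 0))); rewrite addrK subrr.
by have := Fl h i c x 0; rewrite addr0 F0 addr0.
Qed.

Lemma linext_tpure h : linext F (tpure h) = F h.
Proof. exact: linext_gen multilinear_compat h. Qed.

Lemma linext_tpow_linear : linear (linext F : tpow V n -> W).
Proof. exact: linext_linear multilinear_compat. Qed.

End TensorPowerTheory.

Definition tmul (k : comNzRingType) (H : algType k) n (x y : tpow H n) :
    tpow H n :=
  linext (fun a => linext (fun b => tpure [tuple tnth a i * tnth b i | i < n]) y) x.

HB.mixin Record isHopfAlgebra (k : comNzRingType) H of GRing.Algebra k H := {
  comul : H -> tpow H 2;
  counit : H -> k;
  antipode : H -> H;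
  comul_linear : linear comul;
  comul1 : comul 1 = tpure [tuple 1; 1];
  comulM : forall a b, comul (a * b) = tmul (comul a) (comul b);
  counit_linear : scalar counit;
  counit1 : counit 1 = 1;
  counitM : forall a b, counit (a * b) = counit a * counit b;
  antipode_linear : linear antipode;
  comulA : forall h,
    linext (fun u : 2.-tuple H =>
      linext (fun v : 2.-tuple H => tpure [tuple v`_0; v`_1; u`_1]) (comul u`_0))
      (comul h) =
    linext (fun u : 2.-tuple H =>
      linext (fun v : 2.-tuple H => tpure [tuple u`_0; v`_0; v`_1]) (comul u`_1))
      (comul h);
  counitl : forall h,
    linext (fun u : 2.-tuple H => counit u`_0 *: u`_1) (comul h) = h;
  counitr : forall h,
    linext (fun u : 2.-tuple H => counit u`_1 *: u`_0) (comul h) = h;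
  antipodel : forall h,
    linext (fun u : 2.-tuple H => antipode u`_0 * u`_1) (comul h) =
    counit h *: 1;
  antipoder : forall h,
    linext (fun u : 2.-tuple H => u`_0 * antipode u`_1) (comul h) =
    counit h *: 1
}.

#[short(type="hopfAlgType")]
HB.structure Definition HopfAlgebra (k : comNzRingType) :=
  {H of GRing.Algebra k H & isHopfAlgebra k H}.

Definition cocommutative (k : comNzRingType) (H : hopfAlgType k) : Prop :=
  forall h : H,
    linext (fun u : 2.-tuple H => tpure [tuple u`_1; u`_0]) (comul h) = comul h.

Section Sweedler.
Variables (k : comNzRingType) (H : hopfAlgType k).

(** [itcomul m h] is, with [Δ^(m+1) = (id ⊗ Δ^m) Δ], [h^(0) ⊗ ... ⊗ h^(m)]. *)
Fixpoint itcomul (m : nat) : H -> tpow H m.+1 :=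
  match m with
  | 0 => fun h => tpure [tuple h]
  | m'.+1 => fun h =>
      linext (fun u : 2.-tuple H =>
        linext (fun v : m'.+1.-tuple H => tpure [tuple of u`_0 :: v]) (itcomul m' u`_1)) (comul h)
  end.

(** [sweedler h m F] is the summationless expression [F] in which each [h_i] is
    split into [h_i^(0), ..., h_i^(m_i)]; [F] receives in position [i] the list
    of these components, so [h_i^(j)] is [leg c i j]. As everything is extended
    multilinearly, [F] must use every component [h_i^(j)], [j <= m_i], exactly
    once. *)
Fixpoint sweedler (V : lmodType k) (h : seq H) (m : seq nat)
    (F : seq (seq H) -> V) : V :=
  match h, m with
  | a :: h', p :: m' =>
      linext (fun u : p.+1.-tuple H =>
        sweedler h' m' (fun c => F (tval u :: c))) (itcomul p a)
  | _, _ => F [::]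
  end.

Definition leg (c : seq (seq H)) (i j : nat) : H := (nth [::] c i)`_j.

End Sweedler.

(** [d n i : M_(n+1) -> M_n] and [s n i : M_n -> M_(n+1)] are total in [i]; only
    the indices [i <= n+1], resp. [i <= n], are constrained. *)

Record is_simplicial_module (A : pzRingType) (M : nat -> lmodType A)
    (d : forall n, nat -> M n.+1 -> M n)
    (s : forall n, nat -> M n -> M n.+1) : Prop := {
  face_linear : forall n i, (i <= n.+1)%N -> linear (d n i);
  degen_linear : forall n i, (i <= n)%N -> linear (s n i);
  face_face : forall n i j x, (i < j)%N -> (j <= n.+2)%N ->
    d n i (d n.+1 j x) = d n j.-1 (d n.+1 i x);
  degen_degen : forall n i j x, (i <= j)%N -> (j <= n)%N ->
    s n.+1 i (s n j x) = s n.+1 j.+1 (s n i x);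
  face_degen_lt : forall n i j x, (i < j)%N -> (j <= n.+1)%N ->
    d n.+1 i (s n.+1 j x) = s n j.-1 (d n i x);
  face_degen_eq : forall n j x, (j <= n)%N -> d n j (s n j x) = x;
  face_degen_eqS : forall n j x, (j <= n)%N -> d n j.+1 (s n j x) = x;
  face_degen_gt : forall n i j x, (j.+1 < i)%N -> (i <= n.+2)%N ->
    d n.+1 i (s n.+1 j x) = s n j (d n i.-1 x)
}.

Record is_cyclic_module (A : pzRingType) (M : nat -> lmodType A)
    (d : forall n, nat -> M n.+1 -> M n)
    (s : forall n, nat -> M n -> M n.+1)
    (t : forall n, M n -> M n) : Prop := {
  cyclic_simplicial : is_simplicial_module d s;
  cyclic_linear : forall n, linear (t n);
  cyclic_order : forall n x, iter n.+1 (t n) x = x;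
  face_cyclic : forall n i x, (1 <= i <= n.+1)%N ->
    d n i (t n.+1 x) = - t n (d n i.-1 x);
  face0_cyclic : forall n x, d n 0%N (t n.+1 x) = (-1) ^+ n.+1 *: d n n.+1 x;
  degen_cyclic : forall n i x, (1 <= i <= n)%N ->
    s n i (t n x) = - t n.+1 (s n i.-1 x);
  degen0_cyclic : forall n x,
    s n 0%N (t n x) = (-1) ^+ n *: t n.+1 (t n.+1 (s n n x))
}.

(** The carrier is [tpow H n.+1], which is already a [k]-module; [barE] is an
    alias that carries the [H]-module structure instead. *)
Definition barE (k : comNzRingType) (H : hopfAlgType k) (n : nat) : Type :=
  tpow H n.+1.
HB.instance Definition _ (k : comNzRingType) (H : hopfAlgType k) n :=
  GRing.Zmodule.copy (barE H n) (tpow H n.+1).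

Section BarAction.
Variables (k : comNzRingType) (H : hopfAlgType k) (n : nat).

Definition mul_head (a : H) (h : n.+1.-tuple H) : n.+1.-tuple H :=
  tset h ord0 (a * tnth h ord0).

Definition barE_scale (a : H) (x : barE H n) : barE H n :=
  linext (fun h => tpure (mul_head a h)) (x : tpow H n.+1).

Lemma mul_head_multilinear a :
  multilinear (fun h : n.+1.-tuple H => tpure (mul_head a h)).
Proof.
move=> h i c x y.
have E z : mul_head a (tset h i z) =
    tset (mul_head a h) i (if i == ord0 then a * z else z).
  apply: eq_from_tnth => j; rewrite !tnth_mktuple.
  case: (eqVneq i ord0) => [->|i0]; rewrite ?eqxx.
    by case: eqP.
  by case: (eqVneq j ord0) => [->|//]; rewrite (eq_sym ord0) (negPf i0).
rewrite !E; case: ifP => _; last exact: tpure_multilinear.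
by rewrite mulrDr -scalerAr; exact: tpure_multilinear.
Qed.

Lemma barE_scale_pure a (h : n.+1.-tuple H) :
  barE_scale a (tpure h) = tpure (mul_head a h).
Proof. exact: linext_tpure (mul_head_multilinear a) h. Qed.

Lemma barE_scale_linear a :
  linear (barE_scale a : tpow H n.+1 -> tpow H n.+1).
Proof. exact: linext_tpow_linear (mul_head_multilinear a). Qed.

Lemma barE_scaleDr : right_distributive barE_scale +%R.
Proof.
by move=> a x y; have := barE_scale_linear a 1 x y; rewrite !scale1r.
Qed.

Lemma barE_scaleZ a c (x : tpow H n.+1) :
  barE_scale a (c *: x) = c *: (barE_scale a x : tpow H n.+1).
Proof.
have a0 : barE_scale a 0 = 0.
  have := barE_scaleDr a 0 0; rewrite addr0.
  by move/(congr1 (fun z => z - barE_scale a 0)); rewrite addrK subrr.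
by have := barE_scale_linear a c x 0; rewrite a0 !addr0.
Qed.

Lemma barE_ind (P : barE H n -> Prop) :
    (forall h : n.+1.-tuple H, P (tpure h)) ->
    (forall x y, P x -> P y -> P (x + y)) ->
    (forall (c : k) (x : tpow H n.+1), P x -> P (c *: x)) ->
  forall x, P x.
Proof.
move=> Pg PD PZ; apply: (@presented_ind _ _ _ P) => //.
have := PZ 0 (tpure [tuple 0 | i < n.+1]) (Pg _).
by rewrite scale0r.
Qed.

Lemma barE_scaleA a b x : barE_scale a (barE_scale b x) = barE_scale (a * b) x.
Proof.
elim/barE_ind: x => [h|x y IHx IHy|c x IHx].
- rewrite !barE_scale_pure; congr tpure.
  rewrite /mul_head; apply: eq_from_tnth => j.
  rewrite !(tnth_tset, eqxx) mulrA.
  by case: eqP.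
- by rewrite !barE_scaleDr IHx IHy.
- by rewrite !barE_scaleZ IHx.
Qed.

Lemma barE_scale1 : left_id 1 barE_scale.
Proof.
move=> x; elim/barE_ind: x => [h|x y IHx IHy|c x IHx].
- rewrite barE_scale_pure; congr tpure.
  apply: eq_from_tnth => j; rewrite tnth_mktuple.
  by case: eqP => // ->; rewrite mul1r.
- by rewrite barE_scaleDr IHx IHy.
- by rewrite barE_scaleZ IHx.
Qed.

Lemma barE_scaleDl x : {morph barE_scale^~ x : a b / a + b}.
Proof.
move=> a b; elim/barE_ind: x => [h|x y IHx IHy|c x IHx].
- rewrite !barE_scale_pure /mul_head mulrDl.
  by have := tpure_multilinear h ord0 1 (a * tnth h ord0) (b * tnth h ord0);
    rewrite !scale1r.
- by rewrite !barE_scaleDr IHx IHy addrACA.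
- by rewrite !barE_scaleZ IHx scalerDr.
Qed.

HB.instance Definition _ := GRing.Zmodule_isLmodule.Build H (barE H n)
  barE_scaleA barE_scale1 barE_scaleDr barE_scaleDl.

End BarAction.

Section BarResolution.
Variables (k : comNzRingType) (H : hopfAlgType k).

Definition bar_face n (i : nat) (x : barE H n.+1) : barE H n :=
  linext (fun h : n.+2.-tuple H =>
    if (i <= n)%N then
      tpure [tuple if (j < i)%N then h`_j
                   else if j == i :> nat then h`_j * h`_j.+1
                   else h`_j.+1 | j < n.+1]
    else counit h`_n.+1 *: tpure [tuple h`_j | j < n.+1])
    (x : tpow H n.+2).

Definition bar_degen n (i : nat) (x : barE H n) : barE H n.+1 :=
  linext (fun h : n.+1.-tuple H =>
    tpure [tuple if (j <= i)%N then h`_j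
                 else if j == i.+1 :> nat then 1
                 else h`_j.-1 | j < n.+2])
    (x : tpow H n.+1).

Definition alpha n (x : tpow H n.+1) : tpow H n.+1 :=
  linext (fun h : n.+1.-tuple H =>
    sweedler h (mkseq (fun i => n - i)%N n.+1)
      (fun c => tpure [tuple \prod_(i < j.+1) leg c i (j - i) | j < n.+1])) x.

Definition beta n (x : tpow H n.+1) : tpow H n.+1 :=
  linext (fun h : n.+1.-tuple H =>
    sweedler h (mkseq (fun i => if (i < n)%N then 1 else 0)%N n.+1)
      (fun c => tpure [tuple if j == 0%N :> nat then leg c 0 0
                             else antipode (leg c j.-1 1) * leg c j 0
                      | j < n.+1])) x.

Definition lambda n (x : tpow H n.+1) : tpow H n.+1 :=
  linext (fun h : n.+1.-tuple H => (-1) ^+ n *: tpure [tuple of rotr 1 h]) x.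

Definition bar_cyc n (x : barE H n) : barE H n :=
  beta (lambda (alpha (x : tpow H n.+1))).

End BarResolution.

(** [balanced ract N] is [M ⊗_H N], as a [k]-module, for a [k]-module [M] with a
    compatible right [H]-action [ract] and a left [H]-module [N]. *)
Section BalancedTensor.
Variables (k : comNzRingType) (H : algType k) (M : lmodType k).
Variables (ract : M -> H -> M) (N : lmodType H).

Inductive balanced_rel : lterm k (M * N) -> lterm k (M * N) -> Prop :=
  | balanced_relDl u v y :
      balanced_rel (LGen (u + v, y)) (LAdd (LGen (u, y)) (LGen (v, y)))
  | balanced_relDr u x y :
      balanced_rel (LGen (u, x + y)) (LAdd (LGen (u, x)) (LGen (u, y)))
  | balanced_relZ c u y :
      balanced_rel (LGen (c *: u, y)) (LScale c (LGen (u, y)))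
  | balanced_relA u a y :
      balanced_rel (LGen (ract u a, y)) (LGen (u, a *: y)).

Definition balanced := presented balanced_rel.
HB.instance Definition _ := GRing.Lmodule.on balanced.

Definition bpure (u : M) (y : N) : balanced := pgen balanced_rel (u, y).

End BalancedTensor.

Section BarComplex.
Variables (k : comNzRingType) (H : hopfAlgType k).

Definition counit_ract (c : k^o) (a : H) : k^o := c * counit a.

(** [id ⊗ f] on [k ⊗_H -]. *)
Definition coinv_map (N N' : lmodType H) (f : N -> N')
    (x : balanced counit_ract N) : balanced counit_ract N' :=
  linext (fun p : k^o * N => bpure counit_ract p.1 (f p.2)) x.

Definition barB (n : nat) : lmodType k := balanced counit_ract (barE H n).

Definition barB_face n (i : nat) : barB n.+1 -> barB n :=
  coinv_map (@bar_face k H n i).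

Definition barB_degen n (i : nat) : barB n -> barB n.+1 :=
  coinv_map (@bar_degen k H n i).

Definition barB_cyc n : barB n -> barB n := coinv_map (@bar_cyc k H n).

End BarComplex.

(* Main.v *)
(** The tensor powers [T_n] of [H] are algebras, and cocommutativity makes the
    iterated coproduct [legs n s : H -> T_n], which puts [h^(0), h^(1), ...] in the
    slots [s_0, s_1, ...], independent of the order of [s]. It is a convolution
    product of slot insertions, hence an algebra morphism when [s] has no repetition.
    In these terms [alpha(h_0 ⊗ ... ⊗ h_n)] is the product over [i] of
    [legs [i; ...; n] h_i], and the faces, the degeneracies and the cyclic operator
    (up to sign) of both [E(H)] and [R(H)] are of the form
    [h_0 ⊗ ... ⊗ h_n |-> \prod_i legs (tau i) h_i] for a map [tau] from slots to lists
    of slots. Such maps compose by substitution of slots, so that all the identities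
    of a cyclic module for [R(H)], and the compatibility of [alpha] with the
    simplicial structures, reduce to identities between lists of indices. *)

From HB Require Import structures.
Require Import Defs.
From mathcomp Require Import all_boot all_algebra zify.
From mathcomp Require boolp.

Set Implicit Arguments.
Unset Strict Implicit.
Unset Printing Implicit Defensive.

Import GRing.Theory.
Local Open Scope ring_scope.

(** * Tensor powers as algebras *)

(** As [H] need not be commutative, the product of the [legs (tau i) h_i] depends on the order of
    its factors, whereas inside a tensor power factors in different slots may be exchanged.
    Substitution of slots is therefore legitimate only if it never exchanges two factors whose
    images fail to commute. Two criteria serve for the structure maps: those of R(H), as outer maps,
    send different slots to disjoint lists; those of E(H), as inner maps, fill the slots in weakly
    increasing order, which tolerates outer maps with overlapping lists, such as alpha.

    The map beta contains the antipode and falls outside this calculus. Once it is known to be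
    inverse to alpha, the relations for t are transported from the rotation of R(H), and the
    explicit formula is checked by applying alpha to the claimed value, where the antipode cancels.

    For the H-linearity of t, alpha turns left multiplication into the diagonal action, and the
    rotation fixes the iterated coproduct of a. The passage to the bar complex is then formal. *)

Section LinearPredicate.
Variables (k : comPzRingType) (U V W : lmodType k).

Lemma lin0 (f : U -> V) : linear f -> f 0 = 0.
Proof. by move=> /(_ (-1) 0 0); rewrite scaler0 addr0 scaleN1r addNr. Qed.

Lemma linD (f : U -> V) : linear f -> {morph f : x y / x + y}.
Proof. by move=> fl x y; have := fl 1 x y; rewrite !scale1r. Qed.

Lemma linZ (f : U -> V) : linear f -> forall c, {morph f : x / c *: x}.
Proof. by move=> fl c x; have := fl c x 0; rewrite (lin0 fl) !addr0. Qed.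

Lemma lin_sum (f : U -> V) I (r : seq I) (F : I -> U) :
  linear f -> f (\sum_(i <- r) F i) = \sum_(i <- r) f (F i).
Proof.
move=> fl; elim: r => [|i r IHr]; first by rewrite !big_nil lin0.
by rewrite !big_cons linD // IHr.
Qed.

Lemma lin_comp (g : V -> W) (f : U -> V) : linear g -> linear f -> linear (g \o f).
Proof. by move=> gl fl c x y /=; rewrite fl gl. Qed.

Lemma lin_id : linear (@id U).
Proof. by []. Qed.

End LinearPredicate.

Section TensorPowerInduction.
Variables (k : comPzRingType) (V : lmodType k) (n : nat).

Lemma tpow_ind (P : tpow V n -> Prop) :
    (forall v, P (tpure v)) -> (forall x y, P x -> P y -> P (x + y)) ->
    (forall c x, P x -> P (c *: x)) ->
  forall x, P x.
Proof.
move=> Pg PD PZ; apply: (@presented_ind _ _ _ P) => //.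
by have := PZ 0 _ (Pg [tuple 0 | i < n]); rewrite scale0r.
Qed.

Lemma tpow_linear_ext (W : lmodType k) (f g : tpow V n -> W) :
  linear f -> linear g -> (forall v, f (tpure v) = g (tpure v)) -> f =1 g.
Proof.
move=> fl gl fg; apply: tpow_ind => //.
- by move=> x y ex ey; rewrite (linD fl) (linD gl) ex ey.
- by move=> c x ex; rewrite (linZ fl) (linZ gl) ex.
Qed.

Lemma tset_id (T : Type) (h : n.-tuple T) i : tset h i (tnth h i) = h.
Proof. by apply: eq_from_tnth => j; rewrite tnth_tset; case: eqP => // ->. Qed.

(** Scalars are absorbed into the first factor, hence the condition on [n]. A concrete list of pure
    tensors allows several Sweedler expressions in the same element to be compared summand by
    summand. *)
Lemma tpow_sum (x : tpow V n) :
  (0 < n)%N -> exists s : seq (n.-tuple V), x = \sum_(v <- s) tpure v.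
Proof.
move=> n_gt0; elim/tpow_ind: x => [v|x y [s ->] [s' ->]|c x [s ->]].
- by exists [:: v]; rewrite big_seq1.
- by exists (s ++ s'); rewrite big_cat.
exists [seq tset v (Ordinal n_gt0) (c *: tnth v (Ordinal n_gt0)) | v <- s].
rewrite big_map scaler_sumr; apply: eq_bigr => v _.
have fl : linear (fun x => tpure (tset v (Ordinal n_gt0) x)).
  exact: tpure_multilinear.
by rewrite (linZ fl) tset_id.
Qed.

End TensorPowerInduction.

Section TensorPowerMul.
Variables (k : comNzRingType) (H : algType k) (n : nat).
Implicit Types (v w : n.-tuple H) (x y : tpow H n).

Definition vmul v w : n.-tuple H := [tuple tnth v i * tnth w i | i < n].

Lemma vmulE v w i : tnth (vmul v w) i = tnth v i * tnth w i.
Proof. by rewrite tnth_mktuple. Qed.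

Lemma vmul_multilinearr v : multilinear (fun w => tpure (vmul v w)).
Proof.
move=> w i c a b.
have E z : vmul v (tset w i z) = tset (vmul v w) i (tnth v i * z).
  apply: eq_from_tnth => j; rewrite !(vmulE, tnth_tset).
  by case: eqP => // ->.
by rewrite !E mulrDr -scalerAr; exact: tpure_multilinear.
Qed.

Lemma vmul_multilinearl w : multilinear (fun v => tpure (vmul v w)).
Proof.
move=> v i c a b.
have E z : vmul (tset v i z) w = tset (vmul v w) i (z * tnth w i).
  apply: eq_from_tnth => j; rewrite !(vmulE, tnth_tset).
  by case: eqP => // ->.
by rewrite !E mulrDl -scalerAl; exact: tpure_multilinear.
Qed.

Lemma tmul_multilinear y :
  multilinear (fun v => linext (fun w => tpure (vmul v w)) y).
Proof.
move=> h i c a b; move: y.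
apply: (@tpow_linear_ext _ _ _ _ _
  (fun z => _ *: linext (fun b => tpure (vmul (tset h i a) b)) z
            + linext (fun b => tpure (vmul (tset h i _) b)) z)).
- exact/linext_tpow_linear/vmul_multilinearr.
- move=> c1 z1 z2.
  rewrite !(linext_tpow_linear (vmul_multilinearr _)).
  by rewrite !scalerDr !scalerA addrACA (mulrC c).
- move=> w; rewrite !(linext_tpure (vmul_multilinearr _)).
  exact: vmul_multilinearl.
Qed.

Lemma tmul_linearl y : linear ((@tmul k H n)^~ y).
Proof. exact/linext_tpow_linear/tmul_multilinear. Qed.

Lemma tmul_purel v y : tmul (tpure v) y = linext (fun w => tpure (vmul v w)) y.
Proof. exact: (linext_tpure (tmul_multilinear y)). Qed.

Lemma tmul_pure v w : tmul (tpure v) (tpure w) = tpure (vmul v w).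
Proof. by rewrite tmul_purel (linext_tpure (vmul_multilinearr v)). Qed.

Lemma tmul_linearr x : linear (tmul x).
Proof.
move=> c y z; move: x; apply: (@tpow_linear_ext _ _ _ _ _
  (fun x => c *: tmul x y + tmul x z)).
- exact: tmul_linearl.
- move=> c' x x'; rewrite !tmul_linearl !scalerDr !scalerA addrACA.
  by rewrite (mulrC c).
- by move=> v; rewrite !tmul_purel (linext_tpow_linear (vmul_multilinearr v)).
Qed.

End TensorPowerMul.

Section TensorPowerAlgebra.
Variables (k : comNzRingType) (H : hopfAlgType k) (n : nat).
Implicit Types (v w : n.-tuple H) (x y z : tpow H n).

Definition tone : tpow H n := tpure [tuple 1 | i < n].

Lemma tmulA : associative (@tmul k H n).
Proof.
move=> x y z; move: x; apply: (@tpow_linear_ext _ _ _ _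
  (fun x => tmul x (tmul y z)) (fun x => tmul (tmul x y) z)).
- exact: tmul_linearl.
- exact: lin_comp (tmul_linearl z) (tmul_linearl y).
move=> u; move: y; apply: (@tpow_linear_ext _ _ _ _
  (fun y => tmul (tpure u) (tmul y z)) (fun y => tmul (tmul (tpure u) y) z)).
- exact: lin_comp (tmul_linearr (tpure u)) (tmul_linearl z).
- exact: lin_comp (tmul_linearl z) (tmul_linearr (tpure u)).
move=> v; move: z; apply: (@tpow_linear_ext _ _ _ _
  (fun z => tmul (tpure u) (tmul (tpure v) z))
  (fun z => tmul (tmul (tpure u) (tpure v)) z)).
- exact: lin_comp (tmul_linearr (tpure u)) (tmul_linearr (tpure v)).
- exact: tmul_linearr.
move=> w; rewrite !tmul_pure; congr tpure.
by apply: eq_from_tnth => i; rewrite !vmulE mulrA.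
Qed.

Lemma tmul1l : left_id tone (@tmul k H n).
Proof.
apply: (@tpow_linear_ext _ _ _ _ (tmul tone) id); first exact: tmul_linearr.
  exact: lin_id.
move=> v; rewrite tmul_pure; congr tpure.
by apply: eq_from_tnth => i; rewrite vmulE tnth_mktuple mul1r.
Qed.

Lemma tmul1r : right_id tone (@tmul k H n).
Proof.
apply: (@tpow_linear_ext _ _ _ _ ((@tmul k H n)^~ tone) id).
- exact: tmul_linearl.
- exact: lin_id.
move=> v; rewrite tmul_pure; congr tpure.
by apply: eq_from_tnth => i; rewrite vmulE tnth_mktuple mulr1.
Qed.

Lemma tmulDl : left_distributive (@tmul k H n) +%R.
Proof. by move=> x y z; exact: (linD (tmul_linearl z)). Qed.

Lemma tmulDr : right_distributive (@tmul k H n) +%R.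
Proof. by move=> x; exact: (linD (tmul_linearr x)). Qed.

(** Serves to separate the unit from zero: the ring structure below must be nontrivial, and a
    presented module does not show by itself that a given generator survives. *)
Definition tcounit : tpow H n -> k^o :=
  linext (fun v => \prod_(i < n) (counit (tnth v i) : k^o)).

Lemma tcounit_multilinear :
  multilinear (fun v : n.-tuple H => \prod_(i < n) (counit (tnth v i) : k^o)).
Proof.
move=> h i c a b.
have E (z : H) : \prod_(j < n) (counit (tnth (tset h i z) j) : k^o) =
    counit z * \prod_(j < n | j != i) (counit (tnth h j) : k^o).
  rewrite (bigD1 i) //= tnth_tset eqxx; congr (_ * _).
  by apply: eq_bigr => j /negPf ji; rewrite tnth_tset ji.
by rewrite !E counit_linear mulrDl -mulrA.
Qed.

Lemma tone_neq0 : tone != 0.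
Proof.
apply/eqP => e; have : tcounit tone = 1.
  rewrite /tcounit (linext_tpure tcounit_multilinear) big1 // => i _.
  by rewrite tnth_mktuple counit1.
have t0 : tcounit 0 = 0 := lin0 (linext_tpow_linear tcounit_multilinear).
rewrite e t0.
by move/esym/eqP; rewrite oner_eq0.
Qed.

HB.instance Definition _ := GRing.Zmodule_isNzRing.Build (tpow H n)
  tmulA tmul1l tmul1r tmulDl tmulDr tone_neq0.

Lemma tscaleAl (c : k) x y : c *: (x * y) = (c *: x) * y.
Proof. by rewrite -(linZ (tmul_linearl y)). Qed.

HB.instance Definition _ :=
  GRing.Lmodule_isLalgebra.Build k (tpow H n) tscaleAl.

Lemma tscaleAr (c : k) x y : c *: (x * y) = x * (c *: y).
Proof. by rewrite -(linZ (tmul_linearr x)). Qed.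

HB.instance Definition _ :=
  GRing.Lalgebra_isAlgebra.Build k (tpow H n) tscaleAr.

Lemma tpureM v w : tpure v * tpure w = tpure (vmul v w).
Proof. exact: tmul_pure. Qed.

Lemma tpure_prod I (r : seq I) (F : I -> n.-tuple H) :
  \prod_(i <- r) tpure (F i) = tpure [tuple \prod_(i <- r) tnth (F i) j | j < n].
Proof.
elim: r => [|i r IHr].
  rewrite big_nil; congr tpure.
  by apply: eq_from_tnth => j; rewrite !tnth_mktuple big_nil.
rewrite big_cons IHr tpureM; congr tpure.
by apply: eq_from_tnth => j; rewrite vmulE !tnth_mktuple big_cons.
Qed.

End TensorPowerAlgebra.

(** * The convolution product *)

Section LinearExtension.
Variables (k : comPzRingType) (V W : lmodType k).

Lemma eq_linext n (F G : n.-tuple V -> W) : F =1 G ->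
  forall x : tpow V n, linext F x = linext G x.
Proof. by move=> /boolp.funext ->. Qed.

Lemma comp_multilinear (U : lmodType k) n (f : W -> U) (F : n.-tuple V -> W) :
  linear f -> multilinear F -> multilinear (f \o F).
Proof. by move=> fl Fl h i; exact: lin_comp fl (Fl h i). Qed.

Lemma linext_comp (U : lmodType k) n (f : W -> U) (F : n.-tuple V -> W)
    (x : tpow V n) :
  linear f -> multilinear F -> f (linext F x) = linext (f \o F) x.
Proof.
move=> fl Fl; have fFl := comp_multilinear fl Fl; move: x.
apply: (@tpow_linear_ext _ _ _ _ (f \o linext F) (linext (f \o F))).
- exact: lin_comp fl (linext_tpow_linear Fl).
- exact: linext_tpow_linear.
- by move=> v; rewrite /= (linext_tpure Fl) (linext_tpure fFl).
Qed.

Lemma bilinear_multilinear (F : V -> V -> W) :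
    (forall a, linear (F a)) -> (forall b, linear (F^~ b)) ->
  multilinear (fun u : 2.-tuple V => F u`_0 u`_1).
Proof.
move=> Fr Fl h i c a b.
have E (z : V) : (tset h i z)`_0 = (if i == ord0 then z else tnth h ord0) /\
    (tset h i z)`_1 = (if i == ord_max then z else tnth h ord_max).
  have T (u : 2.-tuple V) : u`_0 = tnth u ord0 /\ u`_1 = tnth u ord_max.
    by split; rewrite (tnth_nth 0).
  by case: (T (tset h i z)) => -> ->; rewrite !tnth_tset !(eq_sym i).
case: (E a) (E b) (E (c *: a + b)) => -> -> [-> ->] [-> ->].
by case: i {E} => -[|[|//]] i_lt /=; [exact: Fl|exact: Fr].
Qed.

Lemma tpure_linear n (T : V -> n.-tuple V) (h : n.-tuple V) i :
  (forall x, T x = tset h i x) -> linear (fun x => tpure (T x)).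
Proof. by move=> TE c x y; rewrite !TE; exact: tpure_multilinear. Qed.

Lemma tpure2_linearl b : linear (fun a : V => tpure [tuple a; b]).
Proof.
apply: (@tpure_linear _ _ [tuple 0; b] ord0) => x; apply: eq_from_tnth.
by case=> -[|[|//]] ilt; rewrite tnth_tset !(tnth_nth 0).
Qed.

Lemma tpure2_linearr a : linear (fun b : V => tpure [tuple a; b]).
Proof.
apply: (@tpure_linear _ _ [tuple a; 0] ord_max) => x; apply: eq_from_tnth.
by case=> -[|[|//]] ilt; rewrite tnth_tset !(tnth_nth 0).
Qed.

End LinearExtension.

Section Convolution.
Variables (k : comNzRingType) (H : hopfAlgType k).
Implicit Types (A B : algType k) (V : lmodType k) (h a b : H).

Definition conv A (f g : H -> A) : H -> A :=
  fun h => linext (fun u : 2.-tuple H => f u`_0 * g u`_1) (comul h).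

(** The unit of the convolution algebra of linear maps from [H] to [A]. *)
Definition eta A : H -> A := fun h => counit h *: 1.

Definition algmor A B (f : A -> B) :=
  [/\ linear f, f 1 = 1 & {morph f : x y / x * y}].

Lemma comul_sum h : exists s : seq (2.-tuple H), comul h = \sum_(u <- s) tpure u.
Proof. exact: tpow_sum. Qed.

Lemma linext_sum V n (F : n.-tuple H -> V) (s : seq (n.-tuple H)) :
  multilinear F -> linext F (\sum_(u <- s) tpure u) = \sum_(u <- s) F u.
Proof.
move=> Fl; rewrite (lin_sum _ _ (linext_tpow_linear Fl)).
by apply: eq_bigr => u _; rewrite linext_tpure.
Qed.

Lemma mul_linearl A (c : A) : linear ( *%R^~ c).
Proof. by move=> t x y; rewrite /= mulrDl scalerAl. Qed.

Lemma mul_linearr A (c : A) : linear ( *%R c).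
Proof. by move=> t x y; rewrite mulrDr scalerAr. Qed.

Section ConvLinear.
Variables (A : algType k) (f g : H -> A).
Hypotheses (fl : linear f) (gl : linear g).

Lemma conv_multilinear : multilinear (fun u : 2.-tuple H => f u`_0 * g u`_1).
Proof.
apply: (bilinear_multilinear (F := fun a b => f a * g b)) => [a|b].
  exact: lin_comp (mul_linearr (f a)) gl.
exact: lin_comp (mul_linearl (g b)) fl.
Qed.

Lemma conv_linear : linear (conv f g).
Proof.
exact: lin_comp (linext_tpow_linear conv_multilinear) (@comul_linear _ H).
Qed.

(** The same list decomposes the coproduct itself, so that any other convolution product at [h] can
    be expanded along it. *)
Lemma conv_sum h : exists s : seq (2.-tuple H), comul h = \sum_(u <- s) tpure u
  /\ conv f g h = \sum_(u <- s) f u`_0 * g u`_1.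
Proof.
have [s hs] := comul_sum h; exists s; split=> //.
by rewrite /conv hs (linext_sum _ conv_multilinear).
Qed.

Lemma conv1l : conv (@eta A) g = g.
Proof.
apply/boolp.funext => h; rewrite -[in RHS](counitl h).
rewrite (linext_comp _ gl); last first.
  apply: (bilinear_multilinear (F := fun a b => counit a *: b)) => [a|b] c x y.
    by rewrite scalerDr !scalerA mulrC.
  by rewrite counit_linear scalerDl scalerA.
by apply: eq_linext => u; rewrite /= (linZ gl) /eta -scalerAl mul1r.
Qed.

Lemma conv1r : conv f (@eta A) = f.
Proof.
apply/boolp.funext => h; rewrite -[in RHS](counitr h).
rewrite (linext_comp _ fl); last first.
  apply: (bilinear_multilinear (F := fun a b => counit b *: a)) => [a|b] c x y.
    by rewrite counit_linear scalerDl scalerA.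
  by rewrite scalerDr !scalerA mulrC.
by apply: eq_linext => u; rewrite /= (linZ fl) /eta -scalerAr mulr1.
Qed.

Lemma convC : cocommutative H -> (forall a b, f a * g b = g b * f a) ->
  conv f g = conv g f.
Proof.
move=> cocomm fg; apply/boolp.funext => h; rewrite {2}/conv -cocomm.
have gfl : multilinear (fun u : 2.-tuple H => g u`_0 * f u`_1).
  apply: (bilinear_multilinear (F := fun a b => g a * f b)) => [a|b].
    exact: lin_comp (mul_linearr (g a)) fl.
  exact: lin_comp (mul_linearl (f b)) gl.
rewrite (linext_comp _ (linext_tpow_linear gfl)); last first.
  apply: (bilinear_multilinear (F := fun a b => tpure [tuple b; a])) => a.
    exact: tpure2_linearl.
  exact: tpure2_linearr.
by apply: eq_linext => u /=; rewrite (linext_tpure gfl) fg.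
Qed.
End ConvLinear.

Lemma prod_linear (I : eqType) A (r : seq I) i (f : H -> A) (c : I -> A) :
    linear f -> uniq r -> i \in r ->
  linear (fun x => \prod_(j <- r) (if j == i then f x else c j)).
Proof.
move=> fl; elim: r => [//|j r IHr] /= /andP[jr ur].
rewrite in_cons eq_sym; case: (eqVneq j i) => [ji _|/negPf ji /= ir].
  have E x : \prod_(l <- j :: r) (if l == i then f x else c l) =
      f x * \prod_(l <- r) c l.
    rewrite big_cons ji eqxx big_seq [in RHS]big_seq; congr (_ * _).
    by apply: eq_bigr => l lr; case: eqP => // li; rewrite ji -li lr in jr.
  by move=> t x y; rewrite !E; exact: lin_comp (mul_linearl _) fl t x y.
move=> t x y; rewrite !big_cons ji.
exact: lin_comp (mul_linearr (c j)) (IHr ur ir) t x y.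
Qed.

Definition evprod A (phi : nat -> H -> A) n (v : n.-tuple H) : A :=
  \prod_(i < n) phi i (tnth v i).

(** The tensor product of the maps [phi i] followed by the multiplication of [A], in increasing
    order of [i]. The map alpha and the structure maps take [phi i] to be some [legs]; beta needs
    more general factors. *)
Definition ev A (phi : nat -> H -> A) n : tpow H n -> A := linext (evprod phi (n := n)).

Section Ev.
Variables (A : algType k) (phi : nat -> H -> A).
Hypothesis phil : forall i, linear (phi i).

Lemma evprod_multilinear n : multilinear (@evprod A phi n).
Proof.
move=> h i; have := @prod_linear _ A (index_enum 'I_n) i (phi i)
  (fun j => phi j (tnth h j)) (phil i) (index_enum_uniq _) (mem_index_enum i).
move=> L c x y; have E z : evprod phi (tset h i z) =
    \prod_(j < n) (if j == i then phi i z else phi j (tnth h j)).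
  by apply: eq_bigr => j _; rewrite tnth_tset; case: eqP => // ->.
by rewrite !E; exact: L.
Qed.

Lemma ev_linear n : linear (@ev A phi n).
Proof. exact/linext_tpow_linear/evprod_multilinear. Qed.

Lemma ev_pure n (v : n.-tuple H) : ev phi (tpure v) = evprod phi v.
Proof. exact/linext_tpure/evprod_multilinear. Qed.

End Ev.

Section ConvTheory.
Variables (A : algType k) (f g e : H -> A).
Hypotheses (fl : linear f) (gl : linear g) (el : linear e).

(** The image of coassociativity under the linear map that sends x ⊗ y ⊗ z to f(x) g(y) e(z), which
    is [ev phi] for the sequence f, g, e. *)
Lemma convA : conv f (conv g e) = conv (conv f g) e.
Proof.
apply/boolp.funext => h.
pose phi i := if i is 0 then f else if i is 1 then g else e.
have phil i : linear (phi i) by case: i => [|[|i]].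
have tri a b c : ev phi (tpure [tuple a; b; c]) = f a * (g b * e c).
  by rewrite (ev_pure phil) /evprod !big_ord_recl big_ord0 mulr1.
have t3 (T : H -> 3.-tuple H) (v : 3.-tuple H) i :
    (forall x, T x = tset v i x) -> linear (fun x => tpure (T x)).
  exact: tpure_linear.
have := congr1 (ev phi (n := 3)) (comulA h).
have in1 b : multilinear
    (fun v : 2.-tuple H => tpure [tuple v`_0; v`_1; b]).
  apply: (bilinear_multilinear (F := fun x y => tpure [tuple x; y; b])) => a.
    apply: (t3 _ [tuple a; 0; b] (inord 1)) => x; apply: eq_from_tnth.
    by case=> -[|[|[|//]]] ilt; rewrite tnth_tset -val_eqE /= inordK // !(tnth_nth 0).
  apply: (t3 _ [tuple 0; a; b] ord0) => x; apply: eq_from_tnth.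
  by case=> -[|[|[|//]]] ilt; rewrite tnth_tset -val_eqE !(tnth_nth 0).
have in2 a : multilinear
    (fun v : 2.-tuple H => tpure [tuple a; v`_0; v`_1]).
  apply: (bilinear_multilinear (F := fun x y => tpure [tuple a; x; y])) => b.
    apply: (t3 _ [tuple a; b; 0] ord_max) => x; apply: eq_from_tnth.
    by case=> -[|[|[|//]]] ilt; rewrite tnth_tset -val_eqE !(tnth_nth 0).
  apply: (t3 _ [tuple a; 0; b] (inord 1)) => x; apply: eq_from_tnth.
  by case=> -[|[|[|//]]] ilt; rewrite tnth_tset -val_eqE /= inordK // !(tnth_nth 0).
rewrite !(linext_comp _ (ev_linear phil (n := 3))).
- move=> E; rewrite /conv; transitivity
    (linext (fun u : 2.-tuple H => ev phi (linext
      (fun v : 2.-tuple H => tpure [tuple u`_0; v`_0; v`_1]) (comul u`_1)))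
      (comul h)).
    apply: eq_linext => u; rewrite (linext_comp _ (ev_linear phil (n := 3))) //.
    rewrite (linext_comp _ (mul_linearr (f u`_0)) (conv_multilinear gl el)).
    by apply: eq_linext => v; rewrite /= tri.
  rewrite -E; apply: eq_linext => u.
  rewrite /= (linext_comp _ (ev_linear phil (n := 3))) //.
  rewrite (linext_comp _ (mul_linearl (e u`_1)) (conv_multilinear fl gl)).
  by apply: eq_linext => v; rewrite /= tri mulrA.
- apply: (bilinear_multilinear (F := fun x y => linext
    (fun v : 2.-tuple H => tpure [tuple x; v`_0; v`_1]) (comul y))) => a.
    exact: lin_comp (linext_tpow_linear (in2 a)) (@comul_linear _ H).
  move=> c x y; have [s' as'] := comul_sum a.
  rewrite as' !linext_sum // scaler_sumr -big_split.
  apply: eq_bigr => u _ /=.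
  apply: (t3 (fun x => [tuple x; u`_0; u`_1]) [tuple 0; u`_0; u`_1] ord0).
  move=> z; apply: eq_from_tnth.
  by case=> -[|[|[|//]]] ilt; rewrite tnth_tset -val_eqE !(tnth_nth 0).
apply: (bilinear_multilinear (F := fun x y => linext
    (fun v : 2.-tuple H => tpure [tuple v`_0; v`_1; y]) (comul x))) => a.
  move=> c x y; have [s' as'] := comul_sum a.
  rewrite as' !linext_sum // scaler_sumr -big_split.
  apply: eq_bigr => u _ /=.
  apply: (t3 (fun x => [tuple u`_0; u`_1; x]) [tuple u`_0; u`_1; 0] ord_max).
  move=> z; apply: eq_from_tnth.
  by case=> -[|[|[|//]]] ilt; rewrite tnth_tset -val_eqE !(tnth_nth 0).
exact: lin_comp (linext_tpow_linear (in1 a)) (@comul_linear _ H).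
Qed.

Lemma conv_comm (x : A) : (forall a, f a * x = x * f a) ->
  (forall a, g a * x = x * g a) -> forall a, conv f g a * x = x * conv f g a.
Proof.
move=> fx gx a; have [s [_ ->]] := conv_sum fl gl a.
rewrite mulr_suml mulr_sumr; apply: eq_bigr => u _.
by rewrite -mulrA gx !mulrA fx.
Qed.

Lemma conv_morph (B : algType k) (p : A -> B) : linear p ->
    (forall a b, p (f a * g b) = p (f a) * p (g b)) ->
  forall a, p (conv f g a) = conv (p \o f) (p \o g) a.
Proof.
move=> pl pM a; rewrite /conv (linext_comp _ pl (conv_multilinear fl gl)).
by apply: eq_linext => u /=; rewrite pM.
Qed.

End ConvTheory.

Lemma eta_algmor A : algmor (@eta A).
Proof.
split=> [c x y||x y]; rewrite /eta.
- by rewrite counit_linear scalerDl scalerA.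
- by rewrite counit1 scale1r.
- by rewrite counitM -scalerAr mulr1 scalerA mulrC.
Qed.

Lemma conv_algmor A (f g : H -> A) : algmor f -> algmor g ->
  (forall a b, f a * g b = g b * f a) -> algmor (conv f g).
Proof.
case=> fl f1 fM [gl g1 gM] fg; split; first exact: conv_linear.
  by rewrite /conv comul1 (linext_tpure (conv_multilinear fl gl)) /= f1 g1 mulr1.
move=> a b; have [s [sa ->]] := conv_sum fl gl a.
have [s' [sb ->]] := conv_sum fl gl b.
rewrite /conv comulM sa sb (lin_sum _ _ (tmul_linearl _)).
rewrite (lin_sum _ _ (linext_tpow_linear (conv_multilinear fl gl))) mulr_suml.
apply: eq_bigr => u _; rewrite mulr_sumr (lin_sum _ _ (tmul_linearr _)).
rewrite (lin_sum _ _ (linext_tpow_linear (conv_multilinear fl gl))).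
apply: eq_bigr => v _; rewrite tmul_pure (linext_tpure (conv_multilinear fl gl)).
have T (w : 2.-tuple H) : w`_0 = tnth w ord0 /\ w`_1 = tnth w ord_max.
  by split; rewrite (tnth_nth 0).
case: (T (vmul u v)) (T u) (T v) => -> -> [-> ->] [-> ->].
by rewrite !vmulE fM gM !mulrA -(mulrA (f _)) fg !mulrA.
Qed.

(** Composing an algebra morphism with the antipode gives its convolution inverse, on the right here
    and on the left in the next lemma. Every later cancellation of an antipode is one of these
    two. *)
Lemma conv_antipode A (f : H -> A) : algmor f ->
  conv f (f \o antipode) = @eta A.
Proof.
case=> fl f1 fM; apply/boolp.funext => h; rewrite /eta -f1 -(linZ fl) -antipoder.
rewrite (linext_comp _ fl (conv_multilinear (A := H) (@lin_id _ _) _)); last first.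
  exact: antipode_linear.
by apply: eq_linext => u; rewrite /= fM.
Qed.

Lemma antipode_conv A (f : H -> A) : algmor f ->
  conv (f \o antipode) f = @eta A.
Proof.
case=> fl f1 fM; apply/boolp.funext => h; rewrite /eta -f1 -(linZ fl) -antipodel.
rewrite (linext_comp _ fl (conv_multilinear (A := H) _ (@lin_id _ _))); last first.
  exact: antipode_linear.
by apply: eq_linext => u; rewrite /= fM.
Qed.

End Convolution.

(** * Distributing the legs of an iterated coproduct over slots *)

Section Legs.
Variables (k : comNzRingType) (H : hopfAlgType k).
Implicit Types (A : algType k) (n l : nat) (s : seq nat).

(** Outside of the range, [slot n l] is the counit, so that it is an algebra
    morphism for all [l]. *)
Definition slot n l : H -> tpow H n :=
  fun a => if (l < n)%N then tpure [tuple if j == l :> nat then a else 1 | j < n]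
           else eta _ a.

Lemma slotE n (i : 'I_n) a :
  slot n i a = tpure (tset [tuple 1 | j < n] i a).
Proof.
rewrite /slot ltn_ord; congr tpure; apply: eq_from_tnth => j.
by rewrite tnth_tset !tnth_mktuple -val_eqE.
Qed.

Lemma slot_algmor n l : algmor (slot n l).
Proof.
case: (ltnP l n) => ln; last first.
  by rewrite (_ : slot n l = @eta _ _ _);
    [exact: eta_algmor|rewrite /slot ltnNge ln].
have E a := slotE (Ordinal ln) a; rewrite /= in E.
split=> [c x y||x y]; rewrite !E.
- exact: tpure_multilinear.
- congr tpure; apply: eq_from_tnth => j.
  by rewrite tnth_tset !tnth_mktuple; case: eqP.
- rewrite tpureM; congr tpure; apply: eq_from_tnth => j.
  by rewrite vmulE !tnth_tset !tnth_mktuple; case: eqP => //; rewrite mulr1.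
Qed.

Lemma slot_linear n l : linear (slot n l).
Proof. by case: (slot_algmor n l). Qed.
#[local] Hint Extern 0 (GRing.linear_for _ _) => exact: slot_linear : core.

Lemma eta_comm A (a : H) (x : A) : eta A a * x = x * eta A a.
Proof. by rewrite /eta -scalerAl -scalerAr mul1r mulr1. Qed.

Lemma slot_comm n l l' a b : l != l' ->
  slot n l a * slot n l' b = slot n l' b * slot n l a.
Proof.
move=> ll'; rewrite {1 4}/slot; case: ltnP => ln; last exact: eta_comm.
rewrite {1 2}/slot; case: ltnP => l'n; last by rewrite eta_comm.
rewrite !tpureM; congr tpure; apply: eq_from_tnth => j.
rewrite !vmulE !tnth_mktuple; case: eqP => [->|_]; last by rewrite mul1r mulr1.
by rewrite (negPf ll') mul1r mulr1.
Qed.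

Fixpoint legs n s {struct s} : H -> tpow H n :=
  if s is l :: s' then conv (slot n l) (legs n s') else eta (tpow H n).

Lemma legs_linear n s : linear (legs n s).
Proof.
elim: s => [|l s IHs] /=; first by case: (eta_algmor H (tpow H n)).
exact: conv_linear (slot_linear n l) IHs.
Qed.
#[local] Hint Extern 0 (GRing.linear_for _ _) => exact: legs_linear : core.

Lemma legs1 n l : legs n [:: l] = slot n l.
Proof. by rewrite /= conv1r. Qed.

Lemma legs_cat n s s' : legs n (s ++ s') = conv (legs n s) (legs n s').
Proof.
elim: s => [|l s IHs] /=; first by rewrite conv1l.
by rewrite IHs convA.
Qed.

Lemma legs_slot_comm n s l a b : l \notin s ->
  legs n s a * slot n l b = slot n l b * legs n s a.
Proof.
elim: s a => [|l' s IHs] a /=; first by rewrite eta_comm.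
rewrite in_cons negb_or => /andP[ll' ls].
apply: conv_comm => // [a'|a']; last exact: IHs.
by rewrite slot_comm // eq_sym.
Qed.

Lemma legs_comm n s s' a b : ~~ has (mem s) s' ->
  legs n s a * legs n s' b = legs n s' b * legs n s a.
Proof.
elim: s' b => [|l s' IHs] b /=; first by rewrite eta_comm.
rewrite negb_or => /andP[ls ss']; apply/esym; apply: conv_comm => // b'.
  by rewrite legs_slot_comm.
by rewrite IHs.
Qed.

Lemma legs_algmor n s : uniq s -> algmor (legs n s).
Proof.
elim: s => [_|l s IHs /= /andP[ls us]]; first exact: eta_algmor.
apply: conv_algmor; [exact: slot_algmor|exact: IHs|] => a b.
by rewrite legs_slot_comm.
Qed.

(** Cocommutativity acts through this lemma alone. Cyclic rotation only moves the last entry of a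
    slot list to the front, so exchanging two disjoint blocks is enough. *)
Lemma legs_catC n s s' : cocommutative H -> ~~ has (mem s) s' ->
  legs n (s ++ s') = legs n (s' ++ s).
Proof.
move=> cocomm ss'; rewrite !legs_cat; apply: convC => // a b.
exact: legs_comm.
Qed.

Definition legmap m n (tau : nat -> seq nat) : tpow H m -> tpow H n :=
  ev (fun i => legs n (tau i)) (n := m).

Lemma legmap_linear m n tau : linear (@legmap m n tau).
Proof. exact: ev_linear. Qed.

Lemma legmap_pure m n tau (v : m.-tuple H) :
  legmap n tau (tpure v) = \prod_(i < m) legs n (tau i) (tnth v i).
Proof. exact: ev_pure. Qed.

Lemma eq_ev A (phi psi : nat -> H -> A) n : (forall i, (i < n)%N -> phi i = psi i) ->
  ev phi (n := n) =1 ev psi (n := n).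
Proof.
move=> E x; apply: eq_linext => v; apply: eq_bigr => i _.
by rewrite E.
Qed.

Lemma eq_legmap m n tau tau' : (forall i, (i < m)%N -> tau i = tau' i) ->
  @legmap m n tau =1 @legmap m n tau'.
Proof. by move=> E; apply: eq_ev => i /E ->. Qed.

(** [x] is a sum of pure tensors whose factors outside of [s] are [1]. *)
Inductive supported n s : tpow H n -> Prop :=
  | supported_pure v : (forall i : 'I_n, val i \notin s -> tnth v i = 1) ->
      supported s (tpure v)
  | supportedD x y : supported s x -> supported s y -> supported s (x + y)
  | supportedZ c x : supported s x -> supported s (c *: x).

Lemma supported1 n s : supported s (1 : tpow H n).
Proof. by apply: supported_pure => i _; rewrite tnth_mktuple. Qed.

Lemma supported_sub n s s' (x : tpow H n) :
  {subset s <= s'} -> supported s x -> supported s' x.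
Proof.
move=> ss'; elim=> [v vs|{}x y _ ? _ ?|c {}x _ ?].
- by apply: supported_pure => i is'; apply: vs; apply: contra is'; exact: ss'.
- exact: supportedD.
- exact: supportedZ.
Qed.

Lemma supported_slot n s l a (x : tpow H n) :
  supported s x -> supported (l :: s) (x * slot n l a).
Proof.
elim=> [v vs|{}x y _ ? _ ?|c {}x _ ?]; last first.
- by rewrite -scalerAl; exact: supportedZ.
- by rewrite mulrDl; exact: supportedD.
rewrite /slot; case: ltnP => ln.
  rewrite tpureM; apply: supported_pure => i.
  rewrite in_cons negb_or => /andP[/negPf il is'].
  by rewrite vmulE tnth_mktuple il vs ?mulr1.
rewrite -scalerAr mulr1; apply/supportedZ/supported_pure => i.
by rewrite in_cons negb_or => /andP[_]; exact: vs.
Qed.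

Lemma supported_sum n s (r : seq (2.-tuple H)) F :
  (forall u, supported s (F u)) -> supported s (\sum_(u <- r) F u : tpow H n).
Proof.
move=> Fs; elim: r => [|u r IHr]; rewrite (big_nil, big_cons).
  by have := supportedZ 0 (@supported1 n s); rewrite scale0r.
exact: supportedD.
Qed.

Lemma supported_legs n s s' a (x : tpow H n) :
  supported s x -> supported (s' ++ s) (x * legs n s' a).
Proof.
elim: s' s a x => [|l s' IHs] s a x xs /=.
  by rewrite -scalerAr mulr1; exact: supportedZ.
have [r [_ ->]] := conv_sum (slot_linear n l) (legs_linear n s') a.
rewrite mulr_sumr; apply: supported_sum => u; rewrite mulrA.
apply: (@supported_sub _ (s' ++ l :: s)); last exact/IHs/supported_slot.
by move=> j; rewrite !(mem_cat, in_cons); case: (_ == _); rewrite // orbT.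
Qed.

(** A factor multiplied on the right travels left to position [l]; it meets only the later factors
    on its way. *)
Lemma prod_insert A (X : nat -> A) y l m : (l < m)%N ->
    (forall j, (l < j < m)%N -> X j * y = y * X j) ->
  \prod_(j < m) (if j == l :> nat then X j * y else X j) = (\prod_(j < m) X j) * y.
Proof.
elim: m => [//|m IHm] lm Xy; rewrite !big_ord_recr /=.
case: (eqVneq m l) => [ml|ml].
  rewrite mulrA; congr (_ * _ * _); apply: eq_bigr => j _.
  by rewrite -{1}ml (ltn_eqF (ltn_ord j)).
have lm' : (l < m)%N by rewrite ltn_neqAle eq_sym ml -ltnS.
rewrite IHm // => [|j /andP[lj jm]]; last by rewrite Xy // lj ltnW.
by rewrite -!mulrA Xy // lm' /=.
Qed.

Section Ev.
Variables (A : algType k) (phi : nat -> H -> A) (m : nat).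
Hypothesis phia : forall l, (l < m)%N -> algmor (phi l).
Hypothesis phil : forall l, linear (phi l).

Lemma ev1 : ev phi (1 : tpow H m) = 1.
Proof.
rewrite (ev_pure phil) /evprod big1 // => i _; rewrite tnth_mktuple.
by case: (phia (ltn_ord i)).
Qed.

(** Commutation is asked only against slots beyond [l] that [x] really occupies, not for all pairs
    of slots as in [ev_mul]. This is what makes alpha tractable, since its slot lists overlap and
    the images of different slots do not commute. *)
Lemma ev_mul_slot s (x : tpow H m) l a : (l < m)%N -> supported s x ->
    (forall l', l' \in s -> (l < l')%N ->
       forall b c, phi l b * phi l' c = phi l' c * phi l b) ->
  ev phi (x * slot m l a) = ev phi x * phi l a.
Proof.
move=> lm + sc; have evl := ev_linear phil (n := m).
elim=> [v vs|{}x y _ Ex _ Ey|c {}x _ Ex]; last first.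
- by rewrite -scalerAl (linZ evl) Ex scalerAl (linZ evl).
- by rewrite mulrDl (linD evl) Ex Ey -mulrDl (linD evl).
rewrite /slot lm tpureM !(ev_pure phil) /evprod.
pose X j := phi j (nth 1 v j).
have EX (j : 'I_m) : phi j (tnth v j) = X j by rewrite (tnth_nth 1).
rewrite [in RHS](eq_bigr (fun j : 'I_m => X j)); last by move=> j _; exact: EX.
rewrite -(@prod_insert A X (phi l a) l m lm) => [|j /andP[lj jm]].
  apply: eq_bigr => j _; rewrite vmulE tnth_mktuple -EX.
  case: eqP => [jl|_]; last by rewrite mulr1.
  by have [_ _ ->] := phia (ltn_ord j); rewrite jl.
(* An unoccupied slot contains 1, and its image 1 commutes with everything. *)
case: (boolP (j \in s)) => js; first by rewrite sc.
have := EX (Ordinal jm); rewrite vs //= => <-.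
by have [_ -> _] := phia jm; rewrite mul1r mulr1.
Qed.

End Ev.

(** Slots may be substituted one leg at a time: when [l] comes after a slot [l' > l]
    that is already in use, the images of the two slots have to commute. *)
Lemma legmap_mul_legs m n sigma s s' (x : tpow H m) a :
    (forall l, (l < m)%N -> uniq (sigma l)) -> supported s x ->
    all (ltn^~ m) s' ->
    (forall l l', l \in s ++ s' -> l' \in s' -> (l' < l)%N ->
       ~~ has (mem (sigma l)) (sigma l')) ->
  legmap n sigma (x * legs m s' a) =
  legmap n sigma x * legs n (flatten [seq sigma l | l <- s']) a.
Proof.
move=> us; elim: s' s x a => [|l s' IHs] s x a xs /=.
  by rewrite -!scalerAr !mulr1 (linZ (legmap_linear _ _)).
move=> /andP[lm s'm] dis; rewrite legs_cat.
have [r [ar ->]] := conv_sum (slot_linear m l) (legs_linear m s') a.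
rewrite mulr_sumr (lin_sum _ _ (@legmap_linear m n sigma)).
rewrite /conv ar linext_sum; last exact: conv_multilinear.
rewrite mulr_sumr; apply: eq_bigr => u _; rewrite mulrA.
rewrite (IHs (l :: s)) //; last first.
- move=> j j' js j's' j'j; apply: dis => //; last by rewrite in_cons j's' orbT.
  by move: js; rewrite !(mem_cat, in_cons); case: (j == l); rewrite ?orbT.
- exact: supported_slot.
rewrite mulrA; congr (_ * _); apply: ev_mul_slot => //.
- by move=> j jm; apply/legs_algmor/us.
- exact: xs.
move=> j js lj b c; apply: esym; apply: legs_comm; apply: dis => //.
  by rewrite mem_cat js.
by rewrite in_cons eqxx.
Qed.

(** The left-hand side first sorts the legs by their slot in [tpow H m], while the right-hand side
    multiplies them in the order in which they are listed. The two differ by inversions, a slot [l']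
    smaller than [l] being filled later, and for these the images commute because their lists are
    disjoint. *)
Lemma legmap_comp m n p sigma tau (x : tpow H p) :
    (forall l, (l < m)%N -> uniq (sigma l)) ->
    (forall j, (j < p)%N -> all (ltn^~ m) (tau j)) ->
    (forall j j' l l', (j <= j' < p)%N -> l \in tau j -> l' \in tau j' ->
       (l' < l)%N -> ~~ has (mem (sigma l)) (sigma l')) ->
  legmap n sigma (legmap m tau x) =
  legmap n (fun j => flatten [seq sigma l | l <- tau j]) x.
Proof.
move=> us tm dis; move: x.
apply: (@tpow_linear_ext _ _ _ _ (legmap n sigma \o legmap m tau)).
- exact: lin_comp (legmap_linear n sigma) (legmap_linear m tau).
- exact: legmap_linear.
move=> v; rewrite /= !legmap_pure.
(* Induction on the number of factors; the support records which slots are already filled. *)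
have E q : (q <= p)%N ->
    supported (flatten [seq tau j | j <- seq.iota 0 q])
      (\prod_(i < q) legs m (tau i) (nth 1 v i)) /\
    legmap n sigma (\prod_(i < q) legs m (tau i) (nth 1 v i)) =
    \prod_(i < q) legs n (flatten [seq sigma l | l <- tau i]) (nth 1 v i).
  elim: q => [_|q IHq qp].
    rewrite !big_ord0; split; first exact: supported1.
    by apply: ev1 => // l lm; exact/legs_algmor/us.
  have [sq Eq] := IHq (ltnW qp); rewrite !big_ord_recr; split.
    have -> : seq.iota 0 q.+1 = rcons (seq.iota 0 q) q.
      by rewrite -addn1 iotaD cats1.
    rewrite map_rcons -cats1 flatten_cat /= cats0.
    apply: supported_sub (supported_legs (tau q) _ sq) => j.
    by rewrite !mem_cat orbC.
  rewrite /= (legmap_mul_legs _ _ us sq) ?Eq ?tm // => l l'.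
  rewrite mem_cat => /orP[/flatten_mapP[j]|lq l'q]; last first.
    by apply: (dis q q) => //; rewrite leqnn.
  rewrite mem_iota => jq lj l'q; apply: (dis j q) => //.
  by rewrite qp andbT; case/andP: jq => _ /ltnW.
have P (f : nat -> H -> tpow H n) (f' : nat -> H -> tpow H m) :
    (\prod_(i < p) f i (tnth v i) = \prod_(i < p) f i (nth 1 v i)) /\
    (\prod_(i < p) f' i (tnth v i) = \prod_(i < p) f' i (nth 1 v i)).
  by split; apply: eq_bigr => i _; rewrite (tnth_nth 1).
have [-> _] := P (fun i => legs n (flatten [seq sigma l | l <- tau i]))
  (fun i => legs m (tau i)).
have [_ ->] := P (fun i => legs n (tau i)) (fun i => legs m (tau i)).
by case: (E p (leqnn p)).
Qed.
End Legs.

(** * Sweedler sums as products *)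

Section SweedlerProduct.
Variables (k : comNzRingType) (H : hopfAlgType k).
Implicit Types (A : algType k) (V : lmodType k).

Lemma cons_tset (T : Type) n (a x : T) (v : n.-tuple T) i :
  [tuple of a :: tset v i x] = tset [tuple of a :: v] (lift ord0 i) x.
Proof.
apply: eq_from_tnth => j; rewrite tnth_tset.
case: (unliftP ord0 j) => [j' ->|->] //.
by rewrite !tnthS tnth_tset (inj_eq (@lift_inj _ ord0)).
Qed.

Lemma cons_multilinear n (a : H) :
  multilinear (fun v : n.-tuple H => tpure [tuple of a :: v]).
Proof. by move=> v i c x y; rewrite !cons_tset; exact: tpure_multilinear. Qed.

Lemma cons_linear n (v : n.-tuple H) : linear (fun a => tpure [tuple of a :: v]).
Proof.
apply: (@tpure_linear _ _ _ _ [tuple of 0 :: v] ord0) => x.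
apply: eq_from_tnth => j; rewrite tnth_tset.
by case: (unliftP ord0 j) => [j' ->|->] //; rewrite !tnthS.
Qed.

Lemma itcomul_bilinear p (L : H -> tpow H p.+1) : linear L ->
  multilinear (fun u : 2.-tuple H =>
    linext (fun v : p.+1.-tuple H => tpure [tuple of u`_0 :: v]) (L u`_1)).
Proof.
move=> Ll; apply: (bilinear_multilinear (F := fun a b =>
  linext (fun v : p.+1.-tuple H => tpure [tuple of a :: v]) (L b))) => [a|b].
  exact: lin_comp (linext_tpow_linear (cons_multilinear a)) Ll.
move=> c x y; have [s ->] := tpow_sum (L b) (ltn0Sn p).
rewrite !linext_sum; try exact: cons_multilinear.
rewrite scaler_sumr -big_split; apply: eq_bigr => v _.
exact: cons_linear.
Qed.

Lemma itcomul_linear p : linear (@itcomul k H p).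
Proof.
elim: p => [|p IHp].
  apply: (@tpure_linear _ _ _ _ [tuple 0] ord0) => x; apply: eq_from_tnth.
  by case=> -[|//] ilt; rewrite tnth_tset !(tnth_nth 0).
exact: lin_comp (linext_tpow_linear (itcomul_bilinear IHp)) (@comul_linear _ H).
Qed.

(** The iterated convolution product of [phi 0], ..., [phi p]. Unlike [legs] it does not end with
    the unit, so that it matches [itcomul], whose first case is the identity. *)
Fixpoint convs A (phi : nat -> H -> A) p : H -> A :=
  if p is p'.+1 then conv (phi 0%N) (convs (fun j => phi j.+1) p') else phi 0%N.

Lemma ev_itcomul A (phi : nat -> H -> A) p h :
  (forall j, linear (phi j)) -> ev phi (itcomul p h) = convs phi p h.
Proof.
elim: p phi h => [|p IHp] phi h phil /=.
  by rewrite (ev_pure phil) /evprod big_ord_recl big_ord0 mulr1.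
rewrite (linext_comp _ (ev_linear phil (n := p.+2))
  (itcomul_bilinear (itcomul_linear p))).
apply: eq_linext => u /=; rewrite -IHp; last by move=> j; exact: phil.
rewrite (linext_comp _ (ev_linear phil (n := p.+2)) (cons_multilinear _)).
rewrite (linext_comp _ (mul_linearr _)
  (evprod_multilinear (fun j => phil j.+1) (n := p.+1))).
apply: eq_linext => v; rewrite /= (ev_pure phil) /evprod big_ord_recl tnth0.
by congr (_ * _); apply: eq_bigr => j _; rewrite tnthS.
Qed.

Lemma convs_legs n s p : size s = p.+1 ->
  convs (fun j => slot n (nth 0%N s j)) p = legs n s :> (H -> _).
Proof.
elim: p s => [|p IHp] [|l s] //=; last by case=> sp; rewrite -IHp.
by case: s => //= _; rewrite conv1r //; exact: slot_linear.
Qed.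

Lemma eq_convs A (phi psi : nat -> H -> A) p :
  (forall j, (j <= p)%N -> phi j = psi j) -> convs phi p = convs psi p.
Proof.
elim: p phi psi => [|p IHp] phi psi E /=; first exact: E.
by rewrite E // (IHp _ (fun j => psi j.+1)) // => j jp; exact: E.
Qed.

(** The prefix [x] collects the factors already consumed, which makes the induction on [h] possible.
    The outer map [f] leaves room for an antipode applied to a whole product of legs, which is not
    itself an ordered product over [i]. *)
Lemma sweedler_prod_mul A V (f : A -> V) (phi : nat -> nat -> H -> A)
    (h : seq H) (m : seq nat) x :
    linear f -> (forall i j, linear (phi i j)) -> size h = size m ->
  sweedler h m (fun c => f (x *
    \prod_(i < size m) \prod_(j < (nth 0%N m i).+1) phi i j (leg c i j))) =
  f (x * \prod_(i < size m) convs (phi i) (nth 0%N m i) (nth 0 h i)).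
Proof.
move=> fl; elim: h m phi x => [|a h IHh] [|p m] phi x //= phil.
  by move=> _; rewrite !big_ord0.
case=> hm; rewrite big_ord_recl /=.
set P := \prod_(i < size m) _.
transitivity (linext (fun u : p.+1.-tuple H =>
    (fun y => f (x * y * P)) (evprod (phi 0%N) u)) (itcomul p a)).
  apply: eq_linext => u.
  rewrite -(IHh m (fun i => phi i.+1) (x * evprod (phi 0%N) u)) //.
  congr sweedler; apply/boolp.funext => c; congr (f _).
  rewrite big_ord_recl /= mulrA; congr (_ * _ * _).
  by apply: eq_bigr => j _; rewrite (tnth_nth 0).
have gl : linear (fun y => f (x * y * P)).
  exact: lin_comp fl (lin_comp (mul_linearl P) (mul_linearr x)).
rewrite -(linext_comp (f := fun y => f (x * y * P)) _ gl); last first.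
  exact: evprod_multilinear.
by rewrite -mulrA -(ev_itcomul _ _ (phil 0%N)).
Qed.

Lemma sweedler_prod A V (f : A -> V) (phi : nat -> nat -> H -> A) n
    (h : n.-tuple H) (g : nat -> nat) :
    linear f -> (forall i j, linear (phi i j)) ->
  sweedler h (mkseq g n) (fun c => f (
    \prod_(i < n) \prod_(j < (g i).+1) phi i j (leg c i j))) =
  f (\prod_(i < n) convs (phi i) (g i) (tnth h i)).
Proof.
move=> fl phil.
have := @sweedler_prod_mul A V f phi h (mkseq g n) 1 fl phil.
rewrite size_tuple size_mkseq mul1r => /(_ erefl).
under eq_bigr do rewrite nth_mkseq // -tnth_nth.
move=> <-; congr sweedler; apply/boolp.funext => c; rewrite mul1r; congr (f _).
by apply: eq_bigr => i _; rewrite nth_mkseq.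
Qed.

End SweedlerProduct.

Section PickProduct.
Variables (A : pzRingType).

Lemma prod_pick r (a : nat -> A) j :
  \prod_(i < r) (if j == i :> nat then a i else 1) = if (j < r)%N then a j else 1.
Proof.
elim: r => [|r IHr]; rewrite ?big_ord0 // big_ord_recr /= IHr ltnS.
case: (ltngtP j r) => [_|_|->]; rewrite ?mulr1 ?mul1r //.
Qed.

(** Here factor [i] contributes to the slots [i] and [i.+1], as in beta; slot [j] thus receives
    first from [j.-1] and then from [j]. *)
Lemma prod_pick2 r (a b : nat -> A) j :
  \prod_(i < r) ((if j == i :> nat then a i else 1) *
                 (if j == i.+1 :> nat then b i else 1)) =
  (if (0 < j <= r)%N then b j.-1 else 1) * (if (j < r)%N then a j else 1).
Proof.
elim: r => [|r IHr].
  by rewrite big_ord0; case: j => //=; rewrite mulr1.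
rewrite big_ord_recr /= IHr.
case: (ltngtP j r) => [jr|rj|->].
- have -> : j == r.+1 = false by lia.
  have -> : (0 < j <= r.+1)%N = (0 < j)%N by lia.
  by rewrite andbT (_ : (j < r.+1)%N = true) ?mulr1 //; lia.
- rewrite andbF; have -> : (j < r.+1)%N = false by lia.
  have -> : (0 < j <= r.+1)%N = (j == r.+1) by lia.
  by rewrite !mul1r mulr1; case: eqP => // ->.
have -> : r == r.+1 = false by lia.
have -> : (0 < r <= r.+1)%N = (0 < r)%N by lia.
by rewrite ltnSn ?leqnn ?andbT !mulr1.
Qed.

End PickProduct.

Section StructureMaps.
Variables (k : comNzRingType) (H : hopfAlgType k).

Lemma prod_slots r n (q : nat -> nat) (sg : nat -> nat -> nat)
    (a : nat -> nat -> H) :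
    (forall i l, (i < r)%N -> (l < q i)%N -> (sg i l < n)%N) ->
  \prod_(i < r) \prod_(l < q i) slot n (sg i l) (a i l) =
  tpure [tuple \prod_(i < r) \prod_(l < q i)
                 (if j == sg i l :> nat then a i l else 1) | j < n].
Proof.
move=> sgn; pose P i l := [tuple if j == sg i l :> nat then a i l else 1 | j < n].
transitivity (\prod_(i < r) \prod_(l < q i) tpure (P i l)).
  by apply: eq_bigr => i _; apply: eq_bigr => l _; rewrite /slot sgn.
under eq_bigr do rewrite tpure_prod.
rewrite tpure_prod; congr tpure; apply: eq_from_tnth => j.
rewrite !tnth_mktuple; apply: eq_bigr => i _; rewrite tnth_mktuple.
by apply: eq_bigr => l _; rewrite tnth_mktuple.
Qed.

Lemma prod_slot r n (sg : nat -> nat) (a : nat -> H) :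
    (forall i, (i < r)%N -> (sg i < n)%N) ->
  \prod_(i < r) slot n (sg i) (a i) =
  tpure [tuple \prod_(i < r) (if j == sg i :> nat then a i else 1) | j < n].
Proof.
move=> sgn.
have := @prod_slots r n (fun=> 1%N) (fun i _ => sg i) (fun i _ => a i).
under eq_bigr do rewrite big_ord_recl big_ord0 mulr1.
move=> ->; last by move=> i l ir _; exact: sgn.
congr tpure; apply: eq_from_tnth => j; rewrite !tnth_mktuple.
by apply: eq_bigr => i _; rewrite big_ord_recl big_ord0 mulr1.
Qed.

(** The convolution inverse of the unit is the unit; this is the invariance of the counit under the
    antipode. *)
Lemma eta_antipode (A : algType k) : @eta k H A \o antipode = @eta k H A.
Proof.
rewrite -[RHS](antipode_conv (eta_algmor H A)) conv1r //.
apply: lin_comp (@antipode_linear _ H).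
by case: (eta_algmor H A).
Qed.

Definition tau_alpha n i : seq nat := iota i (n.+1 - i).

Lemma alphaE n : @alpha k H n =1 legmap n.+1 (tau_alpha n).
Proof.
move=> x; apply: eq_linext => h.
pose phi i l := @slot k H n.+1 (i + l).
have phil i l : linear (phi i l) by exact: slot_linear.
transitivity (sweedler h (mkseq (fun i => n - i)%N n.+1) (fun c =>
    \prod_(i < n.+1) \prod_(l < (n - i).+1) phi i l (leg c i l))).
  congr sweedler; apply/boolp.funext => c.
  rewrite (@prod_slots n.+1 n.+1 (fun i => (n - i).+1) addn); last by move=> *; lia.
  congr tpure; apply: eq_from_tnth => j; rewrite !tnth_mktuple.
  (* The factors with [i > j] may be added because no leg of such an h_i reaches slot [j]; for
     [i <= j] the leg in slot [j] has number [j - i]. *)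
  rewrite (big_ord_widen n.+1 (fun i => leg c i (j - i))) // big_mkcond.
  apply: eq_bigr => i _.
  have jn := ltn_ord j; case: ltnP => ij; last first.
    by rewrite big1 // => l _; case: eqP => //; lia.
  have := prod_pick (n - i).+1 (leg c i) (j - i).
  rewrite (_ : (j - i < (n - i).+1)%N) => [<-|]; last by lia.
  by apply: eq_bigr => l _; congr (if _ then _ else _); lia.
rewrite (@sweedler_prod _ _ _ _ id phi n.+1 h (fun i => n - i)%N) //.
apply: eq_bigr => i _; congr (_ _).
rewrite -(@convs_legs _ _ _ _ (n - i)); last first.
  by rewrite size_iota subSn // -ltnS.
apply: eq_convs => l ln; rewrite nth_iota // subSn //.
by rewrite -ltnS.
Qed.

(** [beta(h_0 ⊗ ... ⊗ h_n)] is the product over [i] of [phi_beta n.+1 i h_i]; for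
    [i = n] the second slot is out of range, which removes the antipode. *)
Definition phi_beta n i : H -> tpow H n :=
  conv (slot n i) (slot n i.+1 \o @antipode k H).

Lemma phi_beta_linear n i : linear (phi_beta n i).
Proof.
apply: conv_linear; first exact: slot_linear.
exact: lin_comp (slot_linear n i.+1) (@antipode_linear _ H).
Qed.

Lemma betaE n : @beta k H n =1 ev (phi_beta n.+1) (n := n.+1).
Proof.
move=> x; apply: eq_linext => h.
pose g i := if (i < n)%N then 1%N else 0%N.
pose phi i l : H -> tpow H n.+1 :=
  if l is 0 then slot n.+1 i else slot n.+1 i.+1 \o antipode.
have phil i l : linear (phi i l).
  case: l => [|l]; first exact: slot_linear.
  exact: lin_comp (slot_linear n.+1 i.+1) (@antipode_linear _ H).
transitivity (sweedler h (mkseq g n.+1) (fun c =>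
    \prod_(i < n.+1) \prod_(l < (g i).+1) phi i l (leg c i l))).
  congr sweedler; apply/boolp.funext => c.
  pose a i l := if l is 0 then leg c i 0 else antipode (leg c i 1).
  transitivity (\prod_(i < n.+1) \prod_(l < (g i).+1) slot n.+1 (i + l) (a i l)).
    rewrite (@prod_slots n.+1 n.+1 (fun i => (g i).+1) addn); last first.
      by rewrite /g => i l ilt; case: (ltnP i n) => /=; lia.
    congr tpure; apply: eq_from_tnth => j; rewrite !tnth_mktuple.
    transitivity (\prod_(i < n.+1) ((if j == i :> nat then leg c i 0 else 1) *
        (if j == i.+1 :> nat then antipode (leg c i 1) else 1))).
      rewrite (prod_pick2 n.+1 (fun i => leg c i 0)
        (fun i => antipode (leg c i 1))) ltn_ord (ltnW (ltn_ord j)) andbT.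
      by case: (j : nat) => [|j']; rewrite ?mul1r.
    apply: eq_bigr => i _; rewrite /g big_ord_recl /= addn0; congr (_ * _).
    case: ltnP => ilt; first by rewrite big_ord_recl big_ord0 mulr1 addn1.
    rewrite big_ord0; case: eqP => // ji; have := ltn_ord j; lia.
  apply: eq_bigr => i _; apply: eq_bigr => l _.
  rewrite /phi /a /g; case: l => -[|[|l]] lg /=; rewrite ?addn0 ?addn1 //.
  by move: lg; rewrite /g; case: ifP.
rewrite (@sweedler_prod _ _ _ _ id phi n.+1 h g) //.
apply: eq_bigr => i _; rewrite /g /phi_beta; case: ltnP => //= ilt.
rewrite (_ : slot n.+1 i.+1 \o antipode = @eta _ H (tpow H n.+1)).
  by rewrite conv1r //; exact: slot_linear.
rewrite -eta_antipode; apply/boolp.funext => a /=.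
by rewrite /slot ltnS ltnNge ilt.
Qed.

End StructureMaps.

(** * The structure maps of E(H) and R(H) on slots *)

(** [tau_barface] and [tau_bardegen] are the structure maps of [E(H)], while
    [tau_face], [tau_degen] and [tau_rot] are those of [R(H)]. *)
Section SlotMaps.
Implicit Types (i j l n : nat).

Definition tau_barface n i j : seq nat :=
  if (j == n.+1) && (i == n.+1) then [::]
  else [:: if (j <= i)%N then j else j.-1].

Definition tau_bardegen i j : seq nat := [:: if (j <= i)%N then j else j.+1].

Definition tau_face i j : seq nat :=
  if (j < i)%N then [:: j] else if j == i then [::] else [:: j.-1].

Definition tau_degen i j : seq nat :=
  if (j < i)%N then [:: j] else if j == i then [:: i; i.+1] else [:: j.+1].

Definition tau_rot n j : seq nat := [:: if j == n then 0%N else j.+1].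

Lemma flatten_map_singleton (f : nat -> seq nat) g s :
  {in s, forall l, f l = [:: g l]} -> flatten [seq f l | l <- s] = map g s.
Proof. by move=> fg; rewrite -(flatten_map1 g); congr flatten; apply/eq_in_map. Qed.

(** Deleting [i] from the interval from [j] to [n.+1] and closing the gap leaves the interval up to
    [n] that starts at [j] if [j <= i], and at [j.-1] otherwise. For [i = j = n.+1] nothing is left,
    which is the counit in the last bar face. *)
Lemma tau_face_alpha n i j : (i <= n.+1)%N -> (j <= n.+1)%N ->
  flatten [seq tau_face i l | l <- tau_alpha n.+1 j] =
  flatten [seq tau_alpha n l | l <- tau_barface n i j].
Proof.
move=> ilt jlt; rewrite /tau_alpha /tau_barface; case: ifP => [|nij].
  case/andP=> /eqP-> /eqP->; rewrite (_ : n.+2 - n.+1 = 1)%N; last by lia.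
  by rewrite /= /tau_face ltnn eqxx.
rewrite /= cats0; case: leqP => ij.
  rewrite (_ : n.+2 - j = i - j + (n.+1 - i).+1)%N; last by lia.
  rewrite iotaD map_cat flatten_cat (flatten_map_singleton (g := id)); last first.
    by move=> l; rewrite mem_iota /tau_face => lj; rewrite (_ : (l < i)%N = true) //; lia.
  rewrite map_id subnKC //= {1}/tau_face ltnn eqxx /=.
  rewrite (flatten_map_singleton (g := predn)); last first.
    move=> l; rewrite mem_iota /tau_face => /andP[il _].
    by rewrite ltnNge ltnW //= gtn_eqF.
  rewrite -add1n iotaDl -map_comp map_id_in //.
  by rewrite -[in X in _ ++ X](subnKC ij) -iotaD; congr iota; lia.
rewrite (flatten_map_singleton (g := predn)); last first.
  move=> l; rewrite mem_iota /tau_face => /andP[jl _].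
  by rewrite ltnNge ltnW ?(leq_trans ij) //= gtn_eqF // (leq_trans ij).
case: j ij {nij} jlt => // j ij jlt.
by rewrite -add1n iotaDl -map_comp map_id_in //.
Qed.

(** Doubling the point [i] of the interval from [j] to [n] lengthens it if [j <= i] and shifts it
    otherwise. *)
Lemma tau_degen_alpha n i j : (i <= n)%N -> (j <= n)%N ->
  flatten [seq tau_degen i l | l <- tau_alpha n j] =
  flatten [seq tau_alpha n.+1 l | l <- tau_bardegen i j].
Proof.
move=> ilt jlt; rewrite /tau_alpha /tau_bardegen /= cats0; case: leqP => ij.
  rewrite (_ : n.+1 - j = i - j + (n - i).+1)%N; last by lia.
  rewrite iotaD map_cat flatten_cat (flatten_map_singleton (g := id)); last first.
    by move=> l; rewrite mem_iota /tau_degen => lj; rewrite (_ : (l < i)%N = true) //; lia.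
  rewrite map_id subnKC //= {1}/tau_degen ltnn eqxx /=.
  rewrite (flatten_map_singleton (g := succn)); last first.
    move=> l; rewrite mem_iota /tau_degen => /andP[il _].
    by rewrite ltnNge ltnW //= gtn_eqF.
  rewrite (_ : [seq l.+1 | l <- iota i.+1 (n - i)] = iota i.+2 (n - i)); last first.
    by rewrite -[in RHS]add1n iotaDl.
  rewrite (_ : n.+2 - j = i - j + (n - i).+2)%N; last by lia.
  by rewrite iotaD subnKC.
rewrite (flatten_map_singleton (g := succn)); last first.
  move=> l; rewrite mem_iota /tau_degen => /andP[jl _].
  by rewrite ltnNge ltnW ?(leq_trans ij) //= gtn_eqF // (leq_trans ij).
by rewrite -[in RHS]add1n iotaDl; congr (map _ (iota _ _)); lia.
Qed.

End SlotMaps.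

Section BarMaps.
Variables (k : comNzRingType) (H : hopfAlgType k).

Lemma bar_faceE n i : (i <= n.+1)%N ->
  @bar_face k H n i =1 legmap n.+1 (tau_barface n i).
Proof.
move=> ilt x; apply: eq_linext => h; rewrite /evprod.
rewrite leq_eqVlt in ilt; case/orP: ilt => [/eqP -> | ilt].
  rewrite ltnn big_ord_recr /= {2}/tau_barface !eqxx /=.
  rewrite /eta -scalerAr mulr1 (tnth_nth 0) /=; congr (_ *: _).
  transitivity (\prod_(j < n.+1) slot n.+1 j h`_j).
    rewrite (@prod_slot _ _ _ _ id (nth 0 h)) //; congr tpure; apply: eq_from_tnth => j.
    by rewrite !tnth_mktuple (prod_pick n.+1 (nth 0 h)) ltn_ord.
  apply: eq_bigr => j _; rewrite /tau_barface (ltn_eqF (ltn_ord j)) /=.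
  rewrite (ltnW (ltn_ord j)) conv1r; last exact: slot_linear.
  by rewrite (tnth_nth 0).
rewrite -ltnS ilt.
pose f j := if (j <= i)%N then j else j.-1.
transitivity (\prod_(j < n.+2) slot n.+1 (f j) h`_j).
  rewrite (@prod_slot _ _ _ _ f (nth 0 h)) /f; last by move=> j; case: ifP => /=; lia.
  congr tpure; apply: eq_from_tnth => j; rewrite !tnth_mktuple.
  have jn := ltn_ord j; symmetry.
  case: ltngtP => ij.
  - transitivity (\prod_(l < n.+2) (if j == l :> nat then h`_l else 1)).
      apply: eq_bigr => l _; case: (leqP l i) => // il.
      case: eqP => e1; case: eqP => e2 //; lia.
    by rewrite prod_pick leqW.
  - transitivity (\prod_(l < n.+2) (if j.+1 == l :> nat then h`_l else 1)).
      apply: eq_bigr => l _; case: (leqP l i) => il;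
      case: eqP => e1; case: eqP => e2 //; lia.
    by rewrite prod_pick ltnS jn.
  (* Slot [i] receives both h_i and h_(i+1). Written at [j.+1], this is the pattern of [prod_pick2],
     which yields the two factors in the right order. *)
  transitivity (\prod_(l < n.+2) ((if j.+1 == l :> nat then h`_l else 1) *
                                 (if j.+1 == l.+1 :> nat then h`_l else 1))).
    apply: eq_bigr => l _; rewrite -ij; case: (ltngtP l j) => lj.
    - by rewrite !ifF ?mulr1 //; lia.
    - by rewrite [X in _ * X]ifF ?mulr1; [congr (if _ then _ else _)|]; lia.
    by rewrite lj !eqxx (_ : j.+1 == j = false) ?mul1r //; lia.
  rewrite (prod_pick2 n.+2 (nth 0 h) (nth 0 h)) /= !ifT //; lia.
apply: eq_bigr => j _; rewrite /tau_barface (_ : i == n.+1 = false); last by lia.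
by rewrite andbF legs1 (tnth_nth 0).
Qed.

Lemma bar_degenE n i : (i <= n)%N ->
  @bar_degen k H n i =1 legmap n.+2 (tau_bardegen i).
Proof.
move=> ilt x; apply: eq_linext => h; rewrite /evprod.
pose f j := if (j <= i)%N then j else j.+1.
transitivity (\prod_(j < n.+1) slot n.+2 (f j) h`_j).
  rewrite (@prod_slot _ _ _ _ f (nth 0 h)) /f; last by move=> j; case: ifP => /=; lia.
  congr tpure; apply: eq_from_tnth => j; rewrite !tnth_mktuple.
  have jn := ltn_ord j; symmetry; case: leqP => ij.
    transitivity (\prod_(l < n.+1) (if j == l :> nat then h`_l else 1)).
      apply: eq_bigr => l _; case: (leqP l i) => // il.
      case: eqP => e1; case: eqP => e2 //; lia.
    by rewrite prod_pick (leq_ltn_trans ij).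
  case: eqP => ji.
    by rewrite big1 // => l _; case: (leqP l i) => il; case: eqP => //; lia.
  transitivity (\prod_(l < n.+1) (if j.-1 == l :> nat then h`_l else 1)).
    apply: eq_bigr => l _; case: (leqP l i) => il;
    case: eqP => e1; case: eqP => e2 //; lia.
  by rewrite prod_pick (_ : (j.-1 < n.+1)%N) //; lia.
by apply: eq_bigr => j _; rewrite /tau_bardegen legs1 (tnth_nth 0).
Qed.

Lemma lambdaE n (x : tpow H n.+1) :
  lambda x = (-1) ^+ n *: legmap n.+1 (tau_rot n) x.
Proof.
have zl : linear (fun y : tpow H n.+1 => (-1) ^+ n *: y).
  by move=> c y z; rewrite scalerDr !scalerA mulrC.
rewrite /legmap (linext_comp _ zl); last first.
  by apply: evprod_multilinear => i; exact: legs_linear.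
apply: eq_linext => h; congr (_ *: _); rewrite /evprod.
pose f j := if j == n then 0%N else j.+1.
transitivity (\prod_(j < n.+1) slot n.+1 (f j) h`_j); last first.
  by apply: eq_bigr => j _; rewrite /tau_rot legs1 (tnth_nth 0).
rewrite (@prod_slot _ _ _ _ f (nth 0 h)) /f; last by move=> j; case: ifP => /=; lia.
congr tpure; apply: eq_from_tnth => j; rewrite !tnth_mktuple.
rewrite (tnth_nth 0) /= /rotr size_tuple subn1 /= /rot.
have jn := ltn_ord j.
rewrite nth_cat size_drop size_tuple subSnn nth_drop ltnS leqn0.
case: eqP => j0.
  transitivity (\prod_(l < n.+1) (if n == l :> nat then h`_l else 1)).
    by rewrite prod_pick ltnSn j0 addn0.
  apply: eq_bigr => l _; have := ltn_ord l.
  by move=> ln; congr (if _ then _ else _); case: (eqVneq (l : nat) n) => e1; lia.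
rewrite nth_take; last by lia.
transitivity (\prod_(l < n.+1) (if j.-1 == l :> nat then h`_l else 1)).
  by rewrite prod_pick (_ : (j.-1 < n.+1)%N) ?subn1 //; lia.
apply: eq_bigr => l _; have := ltn_ord l.
by move=> ln; congr (if _ then _ else _); case: (eqVneq (l : nat) n) => e1; lia.
Qed.

End BarMaps.

(** * The isomorphism between E(H) and R(H) *)

Section EvMultiplicative.
Variables (k : comNzRingType) (H : hopfAlgType k) (A : algType k).
Variables (phi : nat -> H -> A) (n : nat).
Hypothesis phia : forall l, (l < n)%N -> algmor (phi l).
Hypothesis phil : forall l, linear (phi l).

Lemma ev_slot l a : (l < n)%N -> ev phi (slot n l a) = phi l a.
Proof.
move=> ln; rewrite -(mul1r (slot n l a)).
by rewrite (ev_mul_slot phia phil a ln (supported1 H n [::])) // ev1 // mul1r.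
Qed.

Hypothesis phiC : forall l l' a b, (l < n)%N -> (l' < n)%N -> l != l' ->
  phi l a * phi l' b = phi l' b * phi l a.

Lemma ev_mul : {morph ev phi (n := n) : x y / x * y}.
Proof.
have evl := ev_linear phil (n := n).
move=> x y; move: x; apply: (@tpow_linear_ext _ _ _ _
  (fun x => ev phi (x * y)) (fun x => ev phi x * ev phi y)).
- exact: lin_comp evl (mul_linearl y).
- exact: lin_comp (mul_linearl (ev phi y)) evl.
move=> v; move: y; apply: (@tpow_linear_ext _ _ _ _
  (fun y => ev phi (tpure v * y)) (fun y => ev phi (tpure v) * ev phi y)).
- exact: lin_comp evl (mul_linearr (tpure v)).
- exact: lin_comp (mul_linearr (ev phi (tpure v))) evl.
move=> w; rewrite tpureM !(ev_pure phil) /evprod.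
pose X i := phi i (nth 1 v i); pose Y i := phi i (nth 1 w i).
have -> : \prod_(i < n) phi i (tnth v i) = \prod_(i < n) X i.
  by apply: eq_bigr => i _; rewrite (tnth_nth 1).
have -> : \prod_(i < n) phi i (tnth w i) = \prod_(i < n) Y i.
  by apply: eq_bigr => i _; rewrite (tnth_nth 1).
transitivity (\prod_(i < n) (X i * Y i)).
  apply: eq_bigr => i _; rewrite vmulE; have [_ _ ->] := phia (ltn_ord i).
  by rewrite !(tnth_nth 1).
elim: {-2}n (leqnn n) => [_|q IHq qn]; first by rewrite !big_ord0 mulr1.
rewrite !big_ord_recr /= (IHq (ltnW qn)) !mulrA; congr (_ * _).
rewrite -!mulrA; congr (_ * _); apply: commr_sym; apply: commr_prod => i _.
by apply: phiC => //; [exact: ltn_trans (ltn_ord i) qn|rewrite gtn_eqF].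
Qed.

Lemma ev_legs s a : all (ltn^~ n) s ->
  ev phi (legs n s a) = foldr (fun l f => conv (phi l) f) (@eta _ H A) s a.
Proof.
elim: s a => [|l s IHs] a /= => [_|/andP[ln sn]].
  by rewrite (linZ (ev_linear phil (n := n))) ev1.
rewrite (conv_morph (slot_linear n l) (legs_linear n s)
  (ev_linear phil (n := n))) => [|b c]; last exact: ev_mul.
congr (conv _ _ _); apply/boolp.funext => b /=; first exact: ev_slot.
exact: IHs.
Qed.

End EvMultiplicative.

Section LegMaps.
Variables (k : comNzRingType) (H : hopfAlgType k).

(** The criterion for outer maps from R(H): images of different slots commute, so the order of
    filling is irrelevant. *)
Lemma legmap_comp_disjoint m n p sigma tau (x : tpow H p) :
    (forall l, (l < m)%N -> uniq (sigma l)) ->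
    (forall l l', (l < m)%N -> (l' < m)%N -> l != l' ->
       ~~ has (mem (sigma l)) (sigma l')) ->
    (forall j, (j < p)%N -> all (ltn^~ m) (tau j)) ->
  legmap n sigma (legmap m tau x) =
  legmap n (fun j => flatten [seq sigma l | l <- tau j]) x.
Proof.
move=> us dis tm; apply: legmap_comp => // j j' l l' /andP[jj' j'p] lj l'j' l'l.
apply: dis; last by rewrite gtn_eqF.
  exact: (allP (tm j (leq_ltn_trans jj' j'p))).
exact: (allP (tm j' j'p)).
Qed.

(** The criterion for inner maps from E(H): there are no inversions, so the lists of [sigma] may
    overlap. *)
Lemma legmap_comp_sorted m n p sigma tau (x : tpow H p) :
    (forall l, (l < m)%N -> uniq (sigma l)) ->
    (forall j, (j < p)%N -> all (ltn^~ m) (tau j)) ->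
    (forall j j' l l', (j <= j' < p)%N -> l \in tau j -> l' \in tau j' ->
       (l <= l')%N) ->
  legmap n sigma (legmap m tau x) =
  legmap n (fun j => flatten [seq sigma l | l <- tau j]) x.
Proof.
move=> us tm srt; apply: legmap_comp => // j j' l l' jj' lj l'j'.
by rewrite ltnNge (srt j j').
Qed.

Lemma legmap_id n (x : tpow H n) : legmap n (fun i => [:: i]) x = x.
Proof.
move: x; apply: tpow_linear_ext; [exact: legmap_linear|exact: lin_id|] => v.
rewrite legmap_pure; transitivity (\prod_(i < n) slot n i (nth 0 v i)).
  by apply: eq_bigr => i _; rewrite legs1 (tnth_nth 0).
rewrite (@prod_slot _ _ _ _ id (nth 0 v)) //; congr tpure.
apply: eq_from_tnth => j; rewrite tnth_mktuple.
by rewrite (prod_pick n (nth 0 v)) ltn_ord (tnth_nth 0).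
Qed.

(** [x |-> 1 ⊗ x] *)
Definition shift n : tpow H n -> tpow H n.+1 := legmap n.+1 (fun j => [:: j.+1]).

Lemma shift_linear n : linear (@shift n).
Proof. exact: legmap_linear. Qed.

Lemma shift_mul n : {morph @shift n : x y / x * y}.
Proof.
apply: ev_mul => [l _|l|l l' a b _ _ ll'].
- exact: legs_algmor.
- exact: legs_linear.
by rewrite !legs1 slot_comm.
Qed.

Lemma shift_legs n s a : all (ltn^~ n) s ->
  shift (legs n s a) = legs n.+1 (map succn s) a.
Proof.
move=> sn; rewrite /shift /legmap ev_legs //.
- congr (_ a); elim: s {sn} => //= l s ->; congr conv.
  by rewrite conv1r //; exact: slot_linear.
- by move=> l _; exact: legs_algmor.
- by move=> l; exact: legs_linear.
by move=> l l' b c _ _ ll'; rewrite !legs1 slot_comm.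
Qed.

Lemma tpure_shift n a (v : n.-tuple H) :
  tpure [tuple of a :: v] = slot n.+1 0 a * shift (tpure v).
Proof.
rewrite -[LHS]legmap_id /shift !legmap_pure big_ord_recl tnth0 legs1.
by congr (_ * _); apply: eq_bigr => i _; rewrite tnthS.
Qed.

Lemma tpow_shift_ext n (V : lmodType k) (f g : tpow H n.+1 -> V) :
    linear f -> linear g ->
    (forall a x, f (slot n.+1 0 a * shift x) = g (slot n.+1 0 a * shift x)) ->
  f =1 g.
Proof.
move=> fl gl fg; apply: tpow_linear_ext => // v.
by case/tupleP: v => a v; rewrite tpure_shift.
Qed.

Section Ev.
Variables (A : algType k) (phi : nat -> H -> A).
Hypothesis phil : forall l, linear (phi l).

Lemma ev_slot0_shift n a (x : tpow H n) :
  ev phi (slot n.+1 0 a * shift x) = phi 0%N a * ev (fun i => phi i.+1) x.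
Proof.
move: x; apply: (@tpow_linear_ext _ _ _ _
  (fun x => ev phi (slot n.+1 0 a * shift x))
  (fun x => phi 0%N a * ev (fun i => phi i.+1) x)).
- exact: lin_comp (ev_linear phil (n := n.+1))
    (lin_comp (mul_linearr _) (@shift_linear n)).
- exact: lin_comp (mul_linearr _) (ev_linear (fun i => phil i.+1) (n := n)).
move=> v; rewrite -tpure_shift (ev_pure phil) (ev_pure (fun i => phil i.+1)).
rewrite /evprod big_ord_recl tnth0.
by congr (_ * _); apply: eq_bigr => i _; rewrite tnthS.
Qed.

(** Left multiplication in slot 0 meets only the first factor of the product, so nothing has to
    commute. This is the source of all H-linearity statements. *)
Lemma ev_slot0_mul n a (x : tpow H n.+1) : {morph phi 0%N : b c / b * c} ->
  ev phi (slot n.+1 0 a * x) = phi 0%N a * ev phi x.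
Proof.
move=> phiM; have evl := ev_linear phil (n := n.+1).
move: x; apply: (@tpow_shift_ext _ _ (fun x => ev phi (slot n.+1 0 a * x))
  (fun x => phi 0%N a * ev phi x)).
- exact: lin_comp evl (mul_linearr _).
- exact: lin_comp (mul_linearr _) evl.
move=> b x; have [_ _ slotM] := slot_algmor H n.+1 0.
by rewrite mulrA -slotM !ev_slot0_shift phiM mulrA.
Qed.

End Ev.

Section AlphaBeta.

Lemma tau_alpha_uniq n l : uniq (tau_alpha n l).
Proof. exact: iota_uniq. Qed.

Lemma phi_beta_last n : phi_beta n.+1 n = slot n.+1 n :> (H -> _).
Proof.
rewrite /phi_beta (_ : slot n.+1 n.+1 \o antipode = @eta _ H (tpow H n.+1)).
  by rewrite conv1r //; exact: slot_linear.
rewrite -eta_antipode; apply/boolp.funext => a /=.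
by rewrite /slot ltnn.
Qed.

(** Write D_i for [legs] on the slots i, ..., n. For i < n, alpha turns [phi_beta] into the
    convolution product of D_i and D_(i+1) ∘ S; as D_i is the convolution product of slot i and
    D_(i+1), only slot i remains. The support ensures that no slot beyond i is occupied when this
    factor arrives, so no commutation is required. *)
Lemma alpha_mul_phi_beta n i a (x : tpow H n.+1) : (i < n.+1)%N ->
    supported (iota 0 i.+1) x ->
  legmap n.+1 (tau_alpha n) (x * phi_beta n.+1 i a) =
    legmap n.+1 (tau_alpha n) x * slot n.+1 i a
  /\ supported (iota 0 i.+2) (x * phi_beta n.+1 i a).
Proof.
move=> ilt xs.
have al := @legmap_linear k H n.+1 n.+1 (tau_alpha n).
have step j b (y : tpow H n.+1) : (j < n.+1)%N -> supported (iota 0 j.+1) y ->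
    legmap n.+1 (tau_alpha n) (y * slot n.+1 j b) =
    legmap n.+1 (tau_alpha n) y * legs n.+1 (tau_alpha n j) b.
  move=> jn ys; apply: (ev_mul_slot _ _ _ _ ys) => //.
  - by move=> l _; exact/legs_algmor/tau_alpha_uniq.
  - by move=> l; exact: legs_linear.
  by move=> l; rewrite mem_iota add0n ltnS => /andP[_ lj]; rewrite ltnNge lj.
have sub j b (y : tpow H n.+1) q : (j < q)%N -> supported (iota 0 q) y ->
    supported (iota 0 q) (y * slot n.+1 j b).
  move=> jq ys; apply: supported_sub (supported_slot j b ys) => l.
  by rewrite in_cons => /orP[/eqP->|//]; rewrite mem_iota.
have grow j (y : tpow H n.+1) : supported (iota 0 j) y ->
    supported (iota 0 j.+1) y.
  by apply: supported_sub => l; rewrite !mem_iota !add0n; lia.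
case: (ltngtP i n) ilt => [ilt _| |ilt _]; last first.
- rewrite ilt in xs *; rewrite phi_beta_last; split.
    rewrite step //; congr (_ * _ a).
    by rewrite /tau_alpha subSnn /= conv1r //; exact: slot_linear.
  by apply: sub => //; exact: grow.
- by move=> ni; rewrite ltnS leqNgt ni.
have Sl : linear (slot n.+1 i.+1 \o @antipode k H).
  exact: lin_comp (slot_linear n.+1 i.+1) (@antipode_linear _ H).
have [s [sa E]] := conv_sum (slot_linear n.+1 i) Sl a.
rewrite /phi_beta E mulr_sumr; split; last first.
  apply: supported_sum => u; rewrite mulrA.
  by apply: (sub i.+1) => //; apply: sub => //; exact: grow.
rewrite (lin_sum _ _ al).
transitivity (legmap n.+1 (tau_alpha n) x * conv (legs n.+1 (tau_alpha n i))
    (legs n.+1 (tau_alpha n i.+1) \o antipode) a).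
  rewrite /conv sa linext_sum; last first.
    apply: conv_multilinear; first exact: legs_linear.
    exact: lin_comp (legs_linear _ _) (@antipode_linear _ H).
  rewrite mulr_sumr; apply: eq_bigr => u _ /=; rewrite mulrA step //; last first.
    by apply: sub => //; exact: grow.
  by rewrite step ?mulrA // ltnW.
congr (_ * _).
have -> : tau_alpha n i = i :: tau_alpha n i.+1.
  by rewrite /tau_alpha subSn // ltnW.
rewrite /= -convA; [|exact: slot_linear|exact: legs_linear|]; last first.
  exact: lin_comp (legs_linear _ _) (@antipode_linear _ H).
rewrite conv_antipode; last exact/legs_algmor/tau_alpha_uniq.
by rewrite conv1r //; exact: slot_linear.
Qed.

Lemma betaK n : cancel (@beta k H n) (@alpha k H n).
Proof.
move=> x; rewrite alphaE betaE.
have bl := ev_linear (@phi_beta_linear k H n.+1) (n := n.+1).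
have al := @legmap_linear k H n.+1 n.+1 (tau_alpha n).
move: x; apply: (tpow_linear_ext (lin_comp al bl) (@lin_id _ _)) => v /=.
rewrite (ev_pure (@phi_beta_linear k H n.+1)) /evprod.
rewrite -[RHS]legmap_id legmap_pure.
pose X i := phi_beta n.+1 i (nth 0 v i); pose Y i := slot n.+1 i (nth 0 v i).
transitivity (legmap n.+1 (tau_alpha n) (\prod_(i < n.+1) X i)).
  by congr legmap; apply: eq_bigr => i _; rewrite (tnth_nth 0).
transitivity (\prod_(i < n.+1) Y i); last first.
  by apply: eq_bigr => i _; rewrite legs1 (tnth_nth 0).
have E q : (q <= n.+1)%N -> supported (iota 0 q.+1) (\prod_(i < q) X i) /\
    legmap n.+1 (tau_alpha n) (\prod_(i < q) X i) = \prod_(i < q) Y i.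
  elim: q => [_|q IHq qn].
    rewrite !big_ord0; split; first exact: supported1.
    apply: ev1 => l *; [exact/legs_algmor/tau_alpha_uniq|exact: legs_linear].
  have [sq Eq] := IHq (ltnW qn); rewrite !big_ord_recr /=.
  by case: (alpha_mul_phi_beta (nth 0 v q) qn sq) => -> ?; rewrite Eq.
by case: (E _ (leqnn _)).
Qed.

(** By induction on [n], through
    [alpha(a ⊗ x) = a^(0) ⊗ a^(1) alpha(x)] and
    [beta(a ⊗ x) = a^(0) ⊗ (S a^(1)) beta(x)]. *)
Lemma alphaK n : cancel (@alpha k H n) (@beta k H n).
Proof.
move=> x; rewrite alphaE betaE.
elim: n x => [|n IHn] x.
  rewrite (@eq_legmap _ _ _ _ _ (fun i => [:: i])); last by case.
  rewrite legmap_id -[RHS]legmap_id; apply: eq_ev => -[|//] _.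
  by rewrite phi_beta_last legs1.
have bl m := ev_linear (@phi_beta_linear k H m.+1) (n := m.+1).
have al m := @legmap_linear k H m.+1 m.+1 (tau_alpha m).
move: x; apply: (tpow_shift_ext (lin_comp (bl _) (al _)) (@lin_id _ _)) => a x.
have alS b y : legmap n.+2 (tau_alpha n.+1) (slot n.+2 0 b * shift y) =
    legs n.+2 (tau_alpha n.+1 0) b * shift (legmap n.+1 (tau_alpha n) y).
  rewrite [LHS]ev_slot0_shift; last by move=> l; exact: legs_linear.
  congr (_ * _); rewrite /shift legmap_comp_disjoint.
  - apply: eq_legmap => i _; rewrite (flatten_map1 succn).
    by rewrite /tau_alpha subSS -[in LHS]add1n iotaDl.
  - by [].
  - by move=> l l' _ _ ll' /=; rewrite inE orbF eqSS eq_sym.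
  by move=> j jn; apply/allP => l; rewrite mem_iota => /= /andP[_]; lia.
have beS b y : ev (@phi_beta k H n.+2) (slot n.+2 0 b * shift y) =
    phi_beta n.+2 0 b * shift (ev (@phi_beta k H n.+1) y).
  rewrite ev_slot0_shift; last exact: phi_beta_linear.
  congr (_ * _); move: y; apply: tpow_linear_ext.
  - by apply: ev_linear => i; exact: phi_beta_linear.
  - exact: lin_comp (@shift_linear n.+1) (bl n).
  move=> v; rewrite !ev_pure; try by move=> *; exact: phi_beta_linear.
  rewrite /evprod; have sh1 : shift 1 = 1 :> tpow H n.+2.
    by apply: ev1 => l *; [exact: legs_algmor|exact: legs_linear].
  rewrite (big_morph _ (@shift_mul n.+1) sh1); apply: eq_bigr => i _.
  rewrite /phi_beta (conv_morph (slot_linear _ _) _ (@shift_linear _)); first last.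
  - by move=> *; exact: shift_mul.
  - exact: lin_comp (slot_linear _ _) (@antipode_linear _ H).
  have shs l b' : shift (slot n.+1 l b') = slot n.+2 l.+1 b'.
    have [ln|nl] := ltnP l n.+1.
      by rewrite -legs1 shift_legs /= ?ln // conv1r //; exact: slot_linear.
    by rewrite /slot ltnNge nl ltnNge ltnS nl /= (linZ (@shift_linear n.+1)) sh1.
  by congr (conv _ _ _); apply/boolp.funext => b' /=; rewrite shs.
rewrite /= alS.
have -> : tau_alpha n.+1 0 = 0%N :: map succn (tau_alpha n 0).
  by rewrite /tau_alpha !subn0; congr cons; rewrite -[in RHS](eq_map add1n) -iotaDl.
rewrite [legs _ (_ :: _)]/=.
have ll m s : linear (legs m s : H -> tpow H m) by exact: legs_linear.
have [s [sa ->]] := conv_sum (slot_linear n.+2 0)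
  (ll n.+2 (map succn (tau_alpha n 0))) a.
have tn : all (ltn^~ n.+1) (tau_alpha n 0).
  by apply/allP => l; rewrite mem_iota.
rewrite mulr_suml (lin_sum _ _ (bl n.+1)).
transitivity (\sum_(u <- s) phi_beta n.+2 0 u`_0 * slot n.+2 1 u`_1 * shift x).
  apply: eq_bigr => u _; rewrite -!mulrA -shift_legs // -shift_mul beS.
  (* The diagonal action of a^(1) on alpha(x) is drawn inside alpha, so that the induction
     hypothesis applies to a^(1) x. *)
  have E : legs n.+1 (tau_alpha n 0) u`_1 * legmap n.+1 (tau_alpha n) x =
      legmap n.+1 (tau_alpha n) (slot n.+1 0 u`_1 * x).
    rewrite [RHS]ev_slot0_mul //; first by move=> l; exact: legs_linear.
    by have [] := legs_algmor H n.+1 (tau_alpha_uniq n 0).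
  rewrite E IHn shift_mul; congr (_ * (_ * _)).
  by rewrite -legs1 shift_legs //= conv1r //; exact: slot_linear.
rewrite -mulr_suml; congr (_ * _).
(* There remains a^(0) ⊗ S(a^(1)) a^(2), which is a ⊗ 1. *)
transitivity (conv (phi_beta n.+2 0) (slot n.+2 1) a).
  rewrite /conv sa linext_sum //.
  apply: conv_multilinear; [exact: phi_beta_linear|exact: slot_linear].
rewrite /phi_beta -convA; try exact: slot_linear; last first.
  exact: lin_comp (slot_linear _ _) (@antipode_linear _ H).
rewrite antipode_conv; last exact: slot_algmor.
by rewrite conv1r //; exact: slot_linear.
Qed.

End AlphaBeta.
End LegMaps.

(** * The cyclic structures *)

Ltac case_ifs := repeat match goal with
  | |- context [if ?b then _ else _] =>
    lazymatch b with
    | context [if _ then _ else _] => fail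
    | _ => case: (boolP b) => ? //=
    end
  end.

(** Each structure map uses lists of at most two slots, so after the case distinctions the side
    conditions and the comparisons of lists are linear arithmetic. *)
Ltac slot_bounds :=
  rewrite /tau_face /tau_degen /tau_rot /tau_barface /tau_bardegen /=;
  case_ifs; rewrite ?inE; lia.

Ltac slot_cases :=
  rewrite /tau_face /tau_degen /tau_rot /tau_barface /tau_bardegen /=;
  case_ifs; try (exfalso; lia); congr cons; try congr cons; lia.

Section RotationRelations.
Variables (k : comNzRingType) (H : hopfAlgType k).
Implicit Types (n i : nat).

Lemma face_rot n i (y : tpow H n.+2) : (1 <= i <= n.+1)%N ->
  legmap n.+1 (tau_face i) (legmap n.+2 (tau_rot n.+1) y) =
  legmap n.+1 (tau_rot n) (legmap n.+1 (tau_face i.-1) y).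
Proof.
move=> ilt; rewrite !legmap_comp_disjoint.
- by apply: eq_legmap => j jlt; slot_cases.
- by move=> l llt; slot_bounds.
- by move=> l l' llt llt' ll'; slot_bounds.
- by move=> j jlt; slot_bounds.
- by move=> l llt; slot_bounds.
- by move=> l l' llt llt' ll'; slot_bounds.
- by move=> j jlt; slot_bounds.
Qed.

Lemma face0_rot n (y : tpow H n.+2) :
  legmap n.+1 (tau_face 0) (legmap n.+2 (tau_rot n.+1) y) =
  legmap n.+1 (tau_face n.+1) y.
Proof.
rewrite legmap_comp_disjoint.
- by apply: eq_legmap => j jlt; slot_cases.
- by move=> l llt; slot_bounds.
- by move=> l l' llt llt' ll'; slot_bounds.
- by move=> j jlt; slot_bounds.
Qed.

Lemma degen_rot n i (y : tpow H n.+1) : (1 <= i <= n)%N ->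
  legmap n.+2 (tau_degen i) (legmap n.+1 (tau_rot n) y) =
  legmap n.+2 (tau_rot n.+1) (legmap n.+2 (tau_degen i.-1) y).
Proof.
move=> ilt; rewrite !legmap_comp_disjoint.
- by apply: eq_legmap => j jlt; slot_cases.
- by move=> l llt; slot_bounds.
- by move=> l l' llt llt' ll'; slot_bounds.
- by move=> j jlt; slot_bounds.
- by move=> l llt; slot_bounds.
- by move=> l l' llt llt' ll'; slot_bounds.
- by move=> j jlt; slot_bounds.
Qed.

Lemma degen0_rot n (y : tpow H n.+1) :
  legmap n.+2 (tau_degen 0) (legmap n.+1 (tau_rot n) y) =
  legmap n.+2 (tau_rot n.+1)
    (legmap n.+2 (tau_rot n.+1) (legmap n.+2 (tau_degen n) y)).
Proof.
rewrite !legmap_comp_disjoint.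
- by apply: eq_legmap => j jlt; slot_cases.
- by move=> l llt; slot_bounds.
- by move=> l l' llt llt' ll'; slot_bounds.
- by move=> j jlt; slot_bounds.
- by move=> l llt; slot_bounds.
- by move=> l l' llt llt' ll'; slot_bounds.
- by move=> j jlt; slot_bounds.
- by move=> l llt; slot_bounds.
- by move=> l l' llt llt' ll'; slot_bounds.
- by move=> j jlt; slot_bounds.
Qed.

Lemma iter_tau_rot n q (y : tpow H n.+1) :
  iter q (legmap n.+1 (tau_rot n)) y =
  legmap n.+1 (fun j => [:: ((j + q) %% n.+1)%N]) y.
Proof.
elim: q => [|q IHq] /=.
  rewrite -[LHS]legmap_id; apply: eq_legmap => j jn.
  by rewrite addn0 modn_small.
rewrite IHq legmap_comp_disjoint.
- apply: eq_legmap => j jn; rewrite /= /tau_rot; congr cons.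
  rewrite addnS -(addn1 (j + q)) -(modnDml (j + q) 1) addn1; have := ltn_pmod (j + q) (ltn0Sn n).
  case: eqP => [->|/eqP ne lt]; first by rewrite modnn.
  by rewrite [RHS]modn_small // ltnS ltn_neqAle ne.
- by move=> l llt; slot_bounds.
- by move=> l l' llt llt' ll'; slot_bounds.
- by move=> j jlt /=; rewrite ltn_pmod.
Qed.

Lemma tau_rot_order n (y : tpow H n.+1) : iter n.+1 (legmap n.+1 (tau_rot n)) y = y.
Proof.
rewrite iter_tau_rot -[RHS]legmap_id; apply: eq_legmap => j jn.
by rewrite modnDr modn_small.
Qed.

(** The diagonal action of [a] is left multiplication by this element. Its invariance under rotation
    makes the cyclic operator H-linear. *)
Lemma rot_legs n (a : H) : cocommutative H ->
  legmap n.+1 (tau_rot n) (legs n.+1 (tau_alpha n 0) a) =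
  legs n.+1 (tau_alpha n 0) a.
Proof.
move=> cocomm; rewrite -(mul1r (legs n.+1 _ a)).
rewrite (legmap_mul_legs _ _ _ (supported1 H n.+1 [::])); first last.
- by move=> l l' _ _ l'l; slot_bounds.
- by apply/allP => l; rewrite mem_iota.
- by move=> l llt; slot_bounds.
have -> : legmap n.+1 (tau_rot n) (1 : tpow H n.+1) = 1.
  by apply: ev1 => l *; [exact: legs_algmor|exact: legs_linear].
rewrite !mul1r; congr (_ a).
(* The rotation carries the list 0, ..., n to 1, ..., n, 0, and a block exchange restores it. *)
rewrite (_ : flatten _ = iota 1 n ++ [:: 0%N]).
  rewrite legs_catC //= orbF mem_iota.
  by rewrite ltnNge.
have -> : tau_alpha n 0 = rcons (iota 0 n) n.
  by rewrite /tau_alpha subn0 -[in LHS]addn1 iotaD cats1.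
rewrite map_rcons -cats1 flatten_cat; congr (_ ++ _); last first.
  by rewrite /= /tau_rot eqxx.
rewrite (flatten_map_singleton (g := addn 1)) -?iotaDl // => l.
rewrite mem_iota add0n => /andP[_ ln].
by rewrite /tau_rot (ltn_eqF ln).
Qed.

End RotationRelations.

(** * The simplicial H-module E(H) *)

Section BarSimplicial.
Variables (k : comNzRingType) (H : hopfAlgType k).
Implicit Types (n i j : nat).

Lemma barE_scaleE n a (x : barE H n) :
  a *: x = (slot n.+1 0 a * (x : tpow H n.+1) : tpow H n.+1).
Proof.
elim/barE_ind: x => [h|x y IHx IHy|c x IHx].
- rewrite [LHS]barE_scale_pure (slotE (@ord0 n)) tpureM; congr tpure.
  apply: eq_from_tnth => i; rewrite vmulE !tnth_tset tnth_mktuple.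
  by case: eqP => [->|_]; rewrite ?mul1r.
- by rewrite scalerDr IHx IHy -mulrDr.
by rewrite [LHS]barE_scaleZ -scalerAr -IHx.
Qed.

Lemma barE_linear m n (f : tpow H m.+1 -> tpow H n.+1) :
    {morph f : x y / x + y} ->
    (forall a x, f (slot m.+1 0 a * x) = slot n.+1 0 a * f x) ->
  linear (f : barE H m -> barE H n).
Proof.
move=> fD fZ a x y; rewrite !barE_scaleE.
by have := fD (slot m.+1 0 a * x) y; rewrite fZ.
Qed.

Lemma legmap_barE_linear m n tau : tau 0%N = [:: 0%N] ->
  linear (legmap n.+1 tau : barE H m -> barE H n).
Proof.
move=> t0; apply: barE_linear => [|a x]; first exact: linD (legmap_linear _ _).
rewrite [LHS]ev_slot0_mul; first by rewrite t0 legs1.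
  by move=> l; exact: legs_linear.
by rewrite t0; case: (@legs_algmor k H n.+1 [:: 0%N]).
Qed.

Lemma bar_face_linear n i : (i <= n.+1)%N ->
  linear (@bar_face k H n i : barE H n.+1 -> barE H n).
Proof.
by move=> ilt a x y; rewrite !bar_faceE //; exact: legmap_barE_linear.
Qed.

Lemma bar_degen_linear n i : (i <= n)%N ->
  linear (@bar_degen k H n i : barE H n -> barE H n.+1).
Proof.
by move=> ilt a x y; rewrite !bar_degenE //; exact: legmap_barE_linear.
Qed.

Ltac compare_slots :=
  rewrite ?legmap_comp_sorted;
  try (by apply: eq_legmap => ? ?; slot_cases);
  try (by move=> ? ?; slot_bounds);
  by move=> ? ? ? ? ?; slot_bounds.

(** Bar faces put neighbouring factors into one slot, so their lists are not disjoint; they are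
    monotone, and the sorted criterion applies to every composite. *)
Lemma bar_simplicial :
  @is_simplicial_module H (fun n => barE H n : lmodType H)
    (@bar_face k H) (@bar_degen k H).
Proof.
split.
- exact: bar_face_linear.
- exact: bar_degen_linear.
- move=> n i j x ij jn; rewrite !bar_faceE; try lia.
  compare_slots.
- move=> n i j x ij jn; rewrite !bar_degenE; try lia.
  compare_slots.
- move=> n i j x ij jn; rewrite !bar_degenE ?bar_faceE; try lia.
  compare_slots.
- move=> n j x jn; rewrite bar_degenE ?bar_faceE; try lia.
  rewrite -[RHS]legmap_id; compare_slots.
- move=> n j x jn; rewrite bar_degenE ?bar_faceE; try lia.
  rewrite -[RHS]legmap_id; compare_slots.
move=> n i j x ij jn; rewrite !bar_degenE ?bar_faceE; try lia.
compare_slots.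
Qed.

End BarSimplicial.

(** * Transport of the cyclic structure from R(H) to E(H) *)

Section BarCyclic.
Variables (k : comNzRingType) (H : hopfAlgType k).
Hypothesis cocomm : cocommutative H.
Implicit Types (n i j : nat).

(** The cyclic operator without its sign, the part to which the calculus of slots applies. *)
Definition rot_bar n (x : tpow H n.+1) : tpow H n.+1 :=
  beta (legmap n.+1 (tau_rot n) (alpha x)).

(** The sign in lambda is a scalar of [k], the signs in the cyclic relations on E(H) are scalars of
    [H]; both become a parity. *)
Lemma signE (R : pzRingType) (V : lmodType R) n (x : V) :
  (-1) ^+ n *: x = if odd n then - x else x.
Proof. by rewrite -signr_odd scaler_sign. Qed.

Lemma beta_linear n : linear (@beta k H n).
Proof.
move=> c x y; rewrite !betaE; exact/ev_linear/phi_beta_linear.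
Qed.

Lemma alpha_linear n : linear (@alpha k H n).
Proof. by move=> c x y; rewrite !alphaE; exact: legmap_linear. Qed.

Lemma rot_bar_linear n : linear (@rot_bar n).
Proof.
exact: lin_comp (@beta_linear n) (lin_comp (legmap_linear _ _) (@alpha_linear n)).
Qed.

Lemma bar_cycE n (x : barE H n) :
  bar_cyc x = ((-1) ^+ n *: rot_bar x : tpow H n.+1).
Proof. by rewrite /bar_cyc lambdaE (linZ (@beta_linear n)). Qed.

Lemma alpha_slot0 n a (x : tpow H n.+1) :
  alpha (slot n.+1 0 a * x) = legs n.+1 (tau_alpha n 0) a * alpha x.
Proof.
rewrite !alphaE [LHS]ev_slot0_mul //; first by move=> l; exact: legs_linear.
by have [] := legs_algmor H n.+1 (tau_alpha_uniq n 0).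
Qed.

Lemma beta_legs n a (x : tpow H n.+1) :
  beta (legs n.+1 (tau_alpha n 0) a * x) = slot n.+1 0 a * beta x.
Proof. by rewrite -{1}(betaK x) -alpha_slot0 alphaK. Qed.

Lemma rot_mul n : {morph @legmap k H n.+1 n.+1 (tau_rot n) : x y / x * y}.
Proof.
apply: ev_mul => [l _|l|l l' a b ln l'n ll'].
- exact: legs_algmor.
- exact: legs_linear.
by apply: legs_comm; slot_bounds.
Qed.

Lemma rot_bar_slot0 n a (x : tpow H n.+1) :
  rot_bar (slot n.+1 0 a * x) = slot n.+1 0 a * rot_bar x.
Proof. by rewrite /rot_bar alpha_slot0 rot_mul rot_legs // beta_legs. Qed.

Lemma bar_cyc_linear n : linear (@bar_cyc k H n : barE H n -> barE H n).
Proof.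
apply: barE_linear => [x y|a x]; rewrite !bar_cycE.
  by rewrite (linD (@rot_bar_linear n)) scalerDr.
by rewrite rot_bar_slot0 scalerAr.
Qed.

(** The two sides are composed by different criteria: before alpha the bar face is monotone, and
    after alpha the face of R(H) has disjoint lists. *)
Lemma alpha_face n i (x : tpow H n.+2) : (i <= n.+1)%N ->
  alpha (bar_face i x) = legmap n.+1 (tau_face i) (alpha x).
Proof.
move=> ilt; rewrite !alphaE bar_faceE // legmap_comp_sorted.
- rewrite legmap_comp_disjoint.
  + by apply: eq_legmap => j jlt; rewrite tau_face_alpha.
  + by move=> l ll; slot_bounds.
  + by move=> l l' llt llt' ll'; slot_bounds.
  + by move=> j jlt; apply/allP => l; rewrite mem_iota => /= /andP[_]; lia.
- by move=> l _; exact: tau_alpha_uniq.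
- by move=> l ll; slot_bounds.
- by move=> ? ? ? ? ?; slot_bounds.
Qed.

Lemma alpha_degen n i (x : tpow H n.+1) : (i <= n)%N ->
  alpha (bar_degen i x) = legmap n.+2 (tau_degen i) (alpha x).
Proof.
move=> ilt; rewrite !alphaE bar_degenE // legmap_comp_sorted.
- rewrite legmap_comp_disjoint.
  + by apply: eq_legmap => j jlt; rewrite tau_degen_alpha.
  + by move=> l ll; slot_bounds.
  + by move=> l l' llt llt' ll'; slot_bounds.
  + by move=> j jlt; apply/allP => l; rewrite mem_iota => /= /andP[_]; lia.
- by move=> l _; exact: tau_alpha_uniq.
- by move=> l ll; slot_bounds.
- by move=> ? ? ? ? ?; slot_bounds.
Qed.

Lemma beta_face n i (x : tpow H n.+2) : (i <= n.+1)%N ->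
  bar_face i (beta x) = beta (legmap n.+1 (tau_face i) x).
Proof. by move=> ilt; rewrite -[LHS](alphaK (n := n)) alpha_face // betaK. Qed.

Lemma beta_degen n i (x : tpow H n.+1) : (i <= n)%N ->
  bar_degen i (beta x) = beta (legmap n.+2 (tau_degen i) x).
Proof. by move=> ilt; rewrite -[LHS](alphaK (n := n.+1)) alpha_degen // betaK. Qed.

Lemma bar_cyclic :
  @is_cyclic_module H (fun n => barE H n : lmodType H)
    (@bar_face k H) (@bar_degen k H) (@bar_cyc k H).
Proof.
have dl n i : (i <= n.+1)%N -> linear (@bar_face k H n i : tpow H n.+2 -> tpow H n.+1).
  by move=> ilt c x y; rewrite !bar_faceE //; exact: legmap_linear.
have sl n i : (i <= n)%N -> linear (@bar_degen k H n i : tpow H n.+1 -> tpow H n.+2).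
  by move=> ilt c x y; rewrite !bar_degenE //; exact: legmap_linear.
split.
- exact: bar_simplicial.
- exact: bar_cyc_linear.
- move=> n x.
  have iterE q : iter q (@bar_cyc k H n) x =
      ((-1) ^+ (n * q) *: (iter q (@rot_bar n) x) : tpow H n.+1).
    elim: q => [|q IHq]; first by rewrite muln0 scale1r.
    rewrite iterS IHq bar_cycE (linZ (@rot_bar_linear n)) scalerA -exprD.
    by rewrite mulnS.
  have iterR q : iter q (@rot_bar n) x =
      beta (iter q (legmap n.+1 (tau_rot n)) (alpha x)).
    elim: q => [|q IHq]; first by rewrite /= alphaK.
    by rewrite iterS IHq /rot_bar betaK -iterS.
  rewrite iterE iterR tau_rot_order alphaK.
  (* The accumulated sign has the even exponent n(n+1). *)
  by rewrite -signr_odd oddM /= andbN scale1r.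
- move=> n i x ilt.
  rewrite !bar_cycE (linZ (dl _ _ _)); last by case/andP: ilt.
  rewrite exprS -scalerA scaleN1r.
  apply: (congr1 (fun z : tpow H n.+1 => - ((-1) ^+ n *: z))).
  rewrite /rot_bar beta_face; last by case/andP: ilt.
  by rewrite face_rot // alpha_face //; lia.
- move=> n x; rewrite bar_cycE (linZ (dl _ _ _)) // !signE.
  by rewrite /rot_bar beta_face // face0_rot -alpha_face // alphaK.
- move=> n i x ilt.
  rewrite !bar_cycE (linZ (sl _ _ _)); last by case/andP: ilt.
  rewrite exprS -scalerA scaleN1r.
  rewrite -[LHS]opprK; apply: (congr1 (fun z : tpow H n.+2 => - - ((-1) ^+ n *: z))).
  rewrite /rot_bar beta_degen; last by case/andP: ilt.
  by rewrite degen_rot // alpha_degen //; lia.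
move=> n x; rewrite !bar_cycE (linZ (sl _ _ _)) //.
(* The signs of the two applications of the operator in degree n+1 cancel. *)
rewrite (linZ (@rot_bar_linear n.+1)) scalerA -exprD addnn -muln2 mulnC exprM.
rewrite sqrrN !expr1n scale1r !signE.
by rewrite /rot_bar beta_degen // degen0_rot betaK -alpha_degen.
Qed.

End BarCyclic.

(** * Coinvariants of a cyclic H-module *)

Section Coinvariants.
Variables (k : comNzRingType) (H : hopfAlgType k).

Section Map.
Variable N : lmodType H.
Local Notation BN := (balanced (@counit_ract k H) N).
Local Notation bN := (bpure (@counit_ract k H) (N := N)).

Lemma bpureDr (u : k^o) (x y : N) : bN u (x + y) = bN u x + bN u y.
Proof. by rewrite pclD; apply/Defs.piP/lrel_base/balanced_relDr. Qed.

Lemma bpureDl (u v : k^o) (y : N) : bN (u + v) y = bN u y + bN v y.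
Proof. by rewrite pclD; apply/Defs.piP/lrel_base/balanced_relDl. Qed.

Lemma bpureZ (c : k) (u : k^o) (y : N) : bN (c *: u) y = c *: bN u y.
Proof. by rewrite pclZ; apply/Defs.piP/lrel_base/balanced_relZ. Qed.

Lemma bpureA (u : k^o) (a : H) (y : N) : bN (u * counit a) y = bN u (a *: y).
Proof. by apply/Defs.piP/lrel_base; exact: (@balanced_relA k H k^o (@counit_ract k H)). Qed.

Lemma bpureN (u : k^o) (y : N) : bN u (- y) = - bN u y.
Proof.
have b0 : bN u 0 = 0.
  by have /eqP := bpureDr u 0 0; rewrite addr0 -subr_eq subrr => /eqP <-.
by apply/eqP; rewrite -addr_eq0 -bpureDr addNr b0.
Qed.

Lemma balanced_ext (V : lmodType k) (f g : BN -> V) :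
  linear f -> linear g -> (forall u y, f (bN u y) = g (bN u y)) -> f =1 g.
Proof.
move=> fl gl fg; apply: presented_ind => [[u y]||x y ex ey|c x ex].
- exact: fg.
- by rewrite (lin0 fl) (lin0 gl).
- by rewrite (linD fl) (linD gl) ex ey.
- by rewrite (linZ fl) (linZ gl) ex.
Qed.

End Map.

Lemma coinv_map_compat (N N' : lmodType H) (f : N -> N') x y : linear f ->
  balanced_rel (@counit_ract k H) (N := N) x y ->
  leval (fun p : k^o * N => bpure (@counit_ract k H) p.1 (f p.2)) x =
  leval (fun p : k^o * N => bpure (@counit_ract k H) p.1 (f p.2)) y.
Proof.
move=> fl; case=> [u v z|u z w|c u z|u a z] /=.
- exact: bpureDl.
- by have := fl 1 z w; rewrite !scale1r => ->; exact: bpureDr.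
- exact: bpureZ.
have -> : f (a *: z) = a *: f z.
  have f0 : f 0 = 0.
    have /eqP := fl 1 0 0; rewrite !scale1r addr0 -subr_eq subrr => /eqP.
    by move=> <-.
  by have := fl a z 0; rewrite f0 !addr0.
exact: bpureA.
Qed.

Lemma coinv_map_pure (N N' : lmodType H) (f : N -> N') u y : linear f ->
  coinv_map f (bpure (@counit_ract k H) u y) = bpure (@counit_ract k H) u (f y).
Proof.
move=> fl.
exact: (linext_gen (fun x y => @coinv_map_compat _ _ f x y fl) (u, y)).
Qed.

Lemma coinv_map_linear (N N' : lmodType H) (f : N -> N') : linear f ->
  linear (@coinv_map k H N N' f).
Proof.
by move=> fl; exact: linext_linear (fun x y => @coinv_map_compat _ _ f x y fl).
Qed.

Variables (M : nat -> lmodType H).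
Variables (d : forall n, nat -> M n.+1 -> M n).
Variables (s : forall n, nat -> M n -> M n.+1).
Variables (t : forall n, M n -> M n).

Lemma coinv_simplicial : is_simplicial_module d s ->
  @is_simplicial_module k (fun n => balanced (@counit_ract k H) (M n) : lmodType k)
    (fun n i => coinv_map (@d n i)) (fun n i => coinv_map (@s n i)).
Proof.
move=> [dl sl dd ss dslt dseq dseqS dsgt].
have dL n i : (i <= n.+1)%N -> linear (coinv_map (k := k) (@d n i)).
  by move=> ilt; exact/coinv_map_linear/dl.
have sL n i : (i <= n)%N -> linear (coinv_map (k := k) (@s n i)).
  by move=> ilt; exact/coinv_map_linear/sl.
(* Functoriality in the form needed: commutative squares of H-linear maps stay commutative, and by
   [E1] so do sections of a retraction. *)
have E (m n m' n' : nat) (f : M m -> M n) (g : M m -> M m') (f' : M n -> M n')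
    (g' : M m' -> M n') : linear f -> linear g -> linear f' -> linear g' ->
    (forall x, f' (f x) = g' (g x)) -> forall x,
    coinv_map (k := k) f' (coinv_map f x) = coinv_map g' (coinv_map g x).
  move=> fl gl f'l g'l fg.
  apply: (balanced_ext (lin_comp (coinv_map_linear f'l) (coinv_map_linear fl))
    (lin_comp (coinv_map_linear g'l) (coinv_map_linear gl))) => u y /=.
  by rewrite !coinv_map_pure // fg.
have E1 (m n : nat) (f : M m -> M n) (f' : M n -> M m) : linear f -> linear f' ->
    (forall x, f' (f x) = x) -> forall x : balanced (@counit_ract k H) (M m),
    coinv_map (k := k) f' (coinv_map f x) = x.
  move=> fl f'l ff.
  apply: (balanced_ext (lin_comp (coinv_map_linear f'l) (coinv_map_linear fl))
    (@lin_id _ _)) => u y /=.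
  by rewrite !coinv_map_pure // ff.
split=> //.
- by move=> n i j x ij jn; apply: E => [||||{}x]; [apply: dl..|exact: dd]; lia.
- by move=> n i j x ij jn; apply: E => [||||{}x]; [apply: sl..|exact: ss]; lia.
- move=> n i j x ij jn; apply: E => [||||{}x].
  + by apply: sl; lia.
  + by apply: dl; lia.
  + by apply: dl; lia.
  + by apply: sl; lia.
  + exact: dslt.
- by move=> n j x jn; apply: E1 => [||{}x]; [exact: sl|exact/dl/leqW|exact: dseq].
- by move=> n j x jn; apply: E1 => [||{}x]; [exact: sl|exact/dl|exact: dseqS].
move=> n i j x ij jn; apply: E => [||||{}x].
- by apply: sl; lia.
- by apply: dl; lia.
- by apply: dl; lia.
- by apply: sl; lia.
- exact: dsgt.
Qed.

(** On a generator u ⊗ y each relation is the one for y; signs of [H] become signs of [k] because u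
    ⊗ y is additive in y. *)
Lemma coinv_cyclic : is_cyclic_module d s t ->
  @is_cyclic_module k (fun n => balanced (@counit_ract k H) (M n) : lmodType k)
    (fun n i => coinv_map (@d n i)) (fun n i => coinv_map (@s n i))
    (fun n => coinv_map (@t n)).
Proof.
move=> [simp tl tK dt dt0 st st0].
have [dl sl _ _ _ _ _ _] := simp.
have tL n := coinv_map_linear (tl n).
have dL n i : (i <= n.+1)%N -> linear (coinv_map (k := k) (@d n i)).
  by move=> ilt; exact/coinv_map_linear/dl.
have sL n i : (i <= n)%N -> linear (coinv_map (k := k) (@s n i)).
  by move=> ilt; exact/coinv_map_linear/sl.
have oppl (V : lmodType k) : linear (fun x : V => - x).
  by move=> c x y; rewrite opprD scalerN.
have scl (V : lmodType k) (e : k) : linear (fun x : V => e *: x).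
  by move=> c x y; rewrite scalerDr !scalerA mulrC.
split=> [|||n i x ilt|n x|n i x ilt|n x].
- exact: coinv_simplicial.
- by move=> n; exact: tL.
- move=> n.
  have itL q : linear (iter q (coinv_map (k := k) (@t n))).
    by elim: q => [//|q IHq]; exact: lin_comp (tL n) IHq.
  apply: (balanced_ext (itL n.+1) (@lin_id _ _)) => u y.
  have E q : iter q (coinv_map (@t n)) (bpure (@counit_ract k H) u y) =
      bpure (@counit_ract k H) u (iter q (@t n) y).
    by elim: q => [//|q IHq]; rewrite !iterS IHq coinv_map_pure.
  by rewrite E tK.
- have i1 : (i <= n.+1)%N by case/andP: ilt.
  have i2 : (i.-1 <= n.+1)%N by lia.
  move: x; apply: (balanced_ext (lin_comp (dL _ _ i1) (tL n.+1))
    (lin_comp (oppl _) (lin_comp (tL n) (dL _ _ i2)))) => u y /=.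
  by rewrite !coinv_map_pure ?dt ?bpureN //; auto.
- move: x; apply: (balanced_ext (lin_comp (dL n 0%N isT) (tL n.+1))
    (lin_comp (scl _ _) (dL _ _ (leqnn _)))) => u y /=.
  rewrite !coinv_map_pure ?dt0 //; auto.
  by rewrite !signE; case: ifP => _; rewrite ?bpureN.
- have i2 : (i.-1 <= n)%N by lia.
  have i1 : (i <= n)%N by case/andP: ilt.
  move: x; apply: (balanced_ext (lin_comp (sL _ _ i1) (tL n))
    (lin_comp (oppl _) (lin_comp (tL n.+1) (sL _ _ i2)))) => u y /=.
  by rewrite !coinv_map_pure ?st ?bpureN //; auto.
move: x; apply: (balanced_ext (lin_comp (sL n 0%N isT) (tL n))
  (lin_comp (scl _ _) (lin_comp (tL n.+1) (lin_comp (tL n.+1) (sL _ _ (leqnn _)))))) => u y /=.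
rewrite !coinv_map_pure ?st0 //; auto.
by rewrite !signE; case: ifP => _; rewrite ?bpureN.
Qed.

End Coinvariants.

(** * The explicit formula *)

Section ExplicitFormula.
Variables (k : comNzRingType) (H : hopfAlgType k).
Hypothesis cocomm : cocommutative H.

Definition phi_antipode1 (A : algType k) (phi : nat -> H -> A) i : H -> A :=
  if i == 1%N then phi i \o antipode else phi i.

Lemma phi_antipode1_linear (A : algType k) (phi : nat -> H -> A) i :
  (forall j, linear (phi j)) -> linear (phi_antipode1 phi i).
Proof.
move=> phil; rewrite /phi_antipode1; case: eqP => _ //.
exact: lin_comp (phil i) (@antipode_linear _ H).
Qed.

(** The map id ⊗ S ⊗ id ⊗ ... ⊗ id. In the explicit formula S is applied to a whole product of legs;
    splitting it off leaves a map described by slots only. *)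
Definition antipode1 n : tpow H n -> tpow H n :=
  ev (phi_antipode1 (slot n)) (n := n).

Definition vantipode1 n (v : n.-tuple H) : n.-tuple H :=
  [tuple if i == 1%N :> nat then antipode (tnth v i) else tnth v i | i < n].

Lemma antipode1_linear n : linear (@antipode1 n).
Proof.
apply: ev_linear => i; apply: phi_antipode1_linear => j; exact: slot_linear.
Qed.

Lemma antipode1_pure n (v : n.-tuple H) :
  antipode1 (tpure v) = tpure (vantipode1 v).
Proof.
rewrite /antipode1 ev_pure; last first.
  by move=> i; apply: phi_antipode1_linear => j; exact: slot_linear.
rewrite -[RHS]legmap_id legmap_pure; apply: eq_bigr => i _.
by rewrite legs1 tnth_mktuple /phi_antipode1; case: eqP.
Qed.

Lemma alpha_antipode1 n (x : tpow H n.+1) :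
  alpha (antipode1 x) =
  ev (phi_antipode1 (fun i => legs n.+1 (tau_alpha n i))) x.
Proof.
have psil i : linear (phi_antipode1 (fun i => legs n.+1 (tau_alpha n i)) i : H -> _).
  by apply: phi_antipode1_linear => j; exact: legs_linear.
move: x; apply: (tpow_linear_ext
  (lin_comp (@alpha_linear k H n) (@antipode1_linear n.+1)) (ev_linear psil (n := _))).
move=> v; rewrite /= antipode1_pure alphaE legmap_pure (ev_pure psil).
apply: eq_bigr => i _; rewrite tnth_mktuple /phi_antipode1.
by case: eqP.
Qed.

(** The slots of the legs of [h_i] in the explicit formula, before the antipode is
    applied in slot [1]. *)
Definition tau_cyc n i : seq nat :=
  if i == 0 then [:: 0%N] else if i == n then [:: 0%N; 1%N]
  else [:: 0%N; 1%N; i.+1].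

(** The first two factors [D_0(a^(0))] and [D_1(S a^(1))], where [D_i] is
    [legs [i; ...; m+1]], multiply to [slot 0 a], because [D_0] is the convolution
    product of [slot 0] and [D_1]. *)
Lemma ev_tau_degen0 m (x : tpow H m.+1) :
  ev (phi_antipode1 (fun i => legs m.+2 (tau_alpha m.+1 i)))
    (legmap m.+2 (tau_degen 0) x) =
  legmap m.+2 (fun j => if j == 0%N then [:: 0%N] else tau_alpha m.+1 j.+1) x.
Proof.
set psi := phi_antipode1 _.
have psil i : linear (psi i).
  by apply: phi_antipode1_linear => j; exact: legs_linear.
move: x; apply: (tpow_shift_ext
  (lin_comp (ev_linear psil (n := _)) (legmap_linear _ _)) (legmap_linear _ _)).
move=> b y /=; rewrite [legmap m.+2 (tau_degen 0) _]ev_slot0_shift; last first.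
  by move=> l; exact: legs_linear.
rewrite [RHS]ev_slot0_shift; last by move=> l; exact: legs_linear.
have -> : ev (fun i => legs m.+2 (tau_degen 0 i.+1)) y = shift (shift y).
  rewrite /shift legmap_comp_disjoint //.
  - by move=> l l' _ _ ll' /=; rewrite inE orbF eqSS eq_sym.
  - by move=> j jm /=; rewrite ltnS jm.
have -> : legs m.+2 (tau_degen 0 0) = conv (slot m.+2 0) (slot m.+2 1) :> (H -> _).
  by rewrite /= conv1r //; exact: slot_linear.
have [s [sb ->]] := conv_sum (slot_linear m.+2 0) (slot_linear m.+2 1) b.
rewrite mulr_suml (lin_sum _ _ (ev_linear psil (n := _))).
transitivity (\sum_(u <- s) psi 0%N u`_0 * psi 1%N u`_1 *
    ev (fun i => psi i.+2) y).
  apply: eq_bigr => u _; rewrite -!mulrA.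
  have -> : slot m.+2 1 u`_1 = shift (slot m.+1 0 u`_1).
    by rewrite -!legs1 shift_legs.
  rewrite -shift_mul ev_slot0_shift // ev_slot0_shift //.
rewrite -mulr_suml; congr (_ * _).
transitivity (conv (psi 0%N) (psi 1%N) b).
  by rewrite /conv sb linext_sum //; exact: conv_multilinear.
pose D := @legs k H m.+2 (tau_alpha m.+1 1).
transitivity (conv (conv (slot m.+2 0) D) (D \o antipode) b); first by [].
rewrite -[RHS]/(legs m.+2 [:: 0%N] b) legs1.
rewrite -convA; [|exact: slot_linear|exact: legs_linear|]; last first.
  exact: lin_comp (legs_linear _ _) (@antipode_linear _ H).
rewrite conv_antipode; last exact/legs_algmor/tau_alpha_uniq.
by rewrite conv1r //; exact: slot_linear.
Qed.

(** As alpha is injective, it suffices to apply alpha to the claimed value, and beta need not be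
    evaluated. Apart from h_0, the contents of slots 0 and 1 are a^(0) and S(a^(1)) for the single
    product a of the first legs of h_1, ..., h_n, which is the situation of [ev_tau_degen0]. *)
Lemma rot_bar_pure n (h : n.+1.-tuple H) : (1 <= n)%N ->
  rot_bar (tpure h) = antipode1 (legmap n.+1 (tau_cyc n) (tpure h)).
Proof.
case: n h => // m h _; apply: (can_inj (@alphaK k H m.+1)).
rewrite betaK alpha_antipode1 alphaE.
set psi := phi_antipode1 _.
have psil i : linear (psi i).
  by apply: phi_antipode1_linear => j; exact: legs_linear.
(* The slots of h_j after alpha and the rotation: the leg in the last slot goes to slot 0, and
   cocommutativity moves it to the front. *)
pose kappa j := 0%N :: iota j.+1 (m.+1 - j).
transitivity (legmap m.+2 kappa (tpure h)).
  rewrite legmap_comp_disjoint.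
  - apply: eq_ev => j jm; rewrite /kappa.
    have -> : flatten [seq tau_rot m.+1 l | l <- tau_alpha m.+1 j] =
        iota j.+1 (m.+1 - j) ++ [:: 0%N].
      have -> : tau_alpha m.+1 j = rcons (iota j (m.+1 - j)) m.+1.
        rewrite /tau_alpha subSn // -addn1 iotaD cats1; congr rcons; lia.
      rewrite map_rcons -cats1 flatten_cat; congr (_ ++ _); last first.
        by rewrite /= /tau_rot eqxx.
      rewrite (flatten_map_singleton (g := addn 1)) -?iotaDl // => l.
      rewrite mem_iota => lj; rewrite /tau_rot (_ : l == m.+1 = false) //; lia.
    by rewrite legs_catC //= orbF mem_iota.
  - by move=> l ll; slot_bounds.
  - by move=> l l' llt llt' ll'; slot_bounds.
  - by move=> j jlt; apply/allP => l; rewrite mem_iota => /= /andP[_]; lia.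
case/tupleP: h => a v; rewrite !legmap_pure big_ord_recl [X in ev _ X]big_ord_recl !tnth0.
have psiM : {morph psi 0%N : b c / b * c}.
  by have [] := legs_algmor H m.+2 (tau_alpha_uniq m.+1 0).
rewrite (_ : legs m.+2 (tau_cyc m.+1 ord0) = slot m.+2 0); last by rewrite -legs1.
rewrite ev_slot0_mul //.
have -> : kappa ord0 = tau_alpha m.+1 0 by rewrite /kappa /tau_alpha !subn0.
congr (_ * _).
(* The formula for h_1, ..., h_n before slot 0 is doubled: [tau_degen 0] turns [[:: 0; i.+1]] into
   [[:: 0; 1; i.+2]], the value of [tau_cyc] at [i.+1]. The last factor has no third leg. *)
pose eps i := if i == m then [:: 0%N] else [:: 0%N; i.+1].
transitivity (legmap m.+2 (fun i => kappa i.+1) (tpure v)).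
  by rewrite legmap_pure; apply: eq_bigr => i _; rewrite tnthS.
transitivity (ev psi (legmap m.+2 (tau_degen 0) (legmap m.+1 eps (tpure v)))).
  rewrite ev_tau_degen0 legmap_comp.
  - apply: eq_legmap => i im; rewrite /eps /kappa.
    by case: eqP => [->|_] /=; rewrite ?subnn // cats0 /tau_alpha !subSS.
  - by move=> l _; case: eqP => // _; exact: tau_alpha_uniq.
  - by move=> j jm; rewrite /eps; case: eqP => /= jm'; lia.
  move=> j j' l l' jj'; rewrite /eps.
  case: (eqVneq j m) => jm; case: (eqVneq j' m) => j'm; rewrite !inE.
  - by move=> /eqP-> /eqP->.
  - by move=> /eqP->.
  - move=> /orP[/eqP->|/eqP->] /eqP-> //= _.
    by rewrite mem_iota.
  move=> /orP[/eqP->|/eqP->] /orP[/eqP->|/eqP->] //= l'l; last by lia.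
  by rewrite mem_iota.
congr (ev psi _); rewrite legmap_comp_disjoint.
- rewrite legmap_pure; apply: eq_bigr => i _; rewrite tnthS; congr (legs _ _ _).
  by rewrite /eps /tau_cyc lift0 eqSS /=; case: eqP.
- by move=> l ll; slot_bounds.
- by move=> l l' llt llt' ll'; slot_bounds.
- by move=> j jm; rewrite /eps; case: eqP => /= jm'; lia.
Qed.

Lemma sweedler_cyc n (h : n.+1.-tuple H) : (1 <= n)%N ->
  sweedler h
    (mkseq (fun i => if i == 0 then 0 else if i == n then 1 else 2)%N n.+1)
    (fun c => tpure
      [tuple if j == 0%N :> nat then
               leg c 0 0 * \prod_(1 <= i < n.+1) leg c i 0
             else if j == 1%N :> nat then
               antipode (\prod_(1 <= i < n.+1) leg c i 1)
             else leg c j.-1 2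
       | j < n.+1]) =
  antipode1 (legmap n.+1 (tau_cyc n) (tpure h)).
Proof.
move=> n1; pose g i := (if i == 0 then 0 else if i == n then 1 else 2)%N.
pose phi i l := @slot k H n.+1 (nth 0%N (tau_cyc n i) l).
have phil i l : linear (phi i l) by exact: slot_linear.
have sizeE i : size (tau_cyc n i) = (g i).+1.
  by rewrite /tau_cyc /g; case: eqP => // _; case: eqP.
rewrite -/g; transitivity (sweedler h (mkseq g n.+1) (fun c => antipode1
    (\prod_(i < n.+1) \prod_(l < (g i).+1) phi i l (leg c i l)))).
  congr sweedler; apply/boolp.funext => c.
  rewrite (@prod_slots _ _ _ _ (fun i => (g i).+1)
    (fun i => nth 0%N (tau_cyc n i)) (leg c)); last first.
    move=> i l ilt; rewrite /g /tau_cyc; case: eqP => [|i0]; first by case: l.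
    by case: eqP => [|iN]; case: l => [|[|[|]]] //=; lia.
  rewrite antipode1_pure; congr tpure; apply: eq_from_tnth => j.
  rewrite !tnth_mktuple.
  have jn := ltn_ord j.
  have big1E (F : nat -> H) : \prod_(1 <= i < n.+1) F i = \prod_(i < n) F i.+1.
    by rewrite big_add1 big_mkord.
  have col0 : \prod_(l < 1) (leg c 0 l) = leg c 0 0.
    by rewrite big_ord_recl big_ord0 mulr1.
  (* The third leg of h_(i+1) lies in slot [i.+2], hence [j.-2]. For h_n this would be slot [n.+1],
     which is out of range, so the uniform expression remains correct. *)
  have inner i : (i < n)%N -> \prod_(l < (g i.+1).+1)
      (if j == nth 0%N (tau_cyc n i.+1) l :> nat then leg c i.+1 l else 1) =
      if j == 0%N :> nat then leg c i.+1 0 else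
      if j == 1%N :> nat then leg c i.+1 1 else
      if j.-2 == i :> nat then leg c i.+1 2 else 1.
    move=> ilt; rewrite /g /tau_cyc /=; case: (eqVneq i.+1 n) => iN /=.
      rewrite !big_ord_recl big_ord0 /=.
      case: eqP => [->|j0] /=; first by rewrite !mulr1.
      case: eqP => j1; rewrite ?mulr1 ?mul1r //.
      by case: eqP => // ji; lia.
    rewrite !big_ord_recl big_ord0 /=.
    case: eqP => [->|j0] /=; first by rewrite !mulr1.
    case: eqP => [->|j1] /=; first by rewrite mul1r !mulr1.
    by rewrite !mul1r mulr1; congr (if _ then _ else _); lia.
  have E : \prod_(i < n.+1) \prod_(l < (g i).+1)
      (if j == nth 0%N (tau_cyc n i) l :> nat then leg c i l else 1) =
      (if j == 0%N :> nat then leg c 0 0 else 1) *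
      \prod_(i < n) (if j == 0%N :> nat then leg c i.+1 0 else
        if j == 1%N :> nat then leg c i.+1 1 else
        if j.-2 == i :> nat then leg c i.+1 2 else 1).
    rewrite big_ord_recl /=; congr (_ * _).
      by rewrite big_ord_recl big_ord0 mulr1.
    by apply: eq_bigr => i _; exact: inner.
  rewrite E !big1E; case: (eqVneq (j : nat) 0%N) => [->|j0] //.
  case: (eqVneq (j : nat) 1%N) => [_|j1]; first by rewrite mul1r.
  rewrite mul1r (prod_pick n (fun i => leg c i.+1 2)).
  rewrite (_ : (j.-2 < n)%N); last by lia.
  by congr leg; lia.
rewrite (@sweedler_prod _ _ _ _ (@antipode1 n.+1) phi n.+1 h g) //; last first.
  exact: antipode1_linear.
congr antipode1; rewrite legmap_pure; apply: eq_bigr => i _.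
by rewrite -(@convs_legs _ _ _ _ (g i)).
Qed.

End ExplicitFormula.

Theorem corollary2p4p1 (k : comNzRingType) (H : hopfAlgType k)
    (H_cocomm : cocommutative H) :
  [/\ @is_cyclic_module H (fun n => barE H n : lmodType H)
        (@bar_face k H) (@bar_degen k H) (@bar_cyc k H),
      @is_cyclic_module k (@barB k H)
        (@barB_face k H) (@barB_degen k H) (@barB_cyc k H),
      forall h : H, bar_cyc (tpure [tuple h]) = tpure [tuple h],
      forall h0 h1 : H,
        bar_cyc (tpure [tuple h0; h1]) =
        - linext (fun u : 2.-tuple H =>
                  tpure [tuple h0 * u`_0; antipode u`_1]) (comul h1)
    & forall (n : nat) (h : n.+1.-tuple H), (1 <= n)%N ->
        bar_cyc (tpure h) =
        (-1) ^+ n *: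
          sweedler h
            (mkseq (fun i => if i == 0 then 0
                             else if i == n then 1 else 2)%N n.+1)
            (fun c => tpure
              [tuple if j == 0%N :> nat then
                       leg c 0 0 * \prod_(1 <= i < n.+1) leg c i 0
                     else if j == 1%N :> nat then
                       antipode (\prod_(1 <= i < n.+1) leg c i 1)
                     else leg c j.-1 2
               | j < n.+1])].
Proof.
have cycE := bar_cyclic H_cocomm.
split=> [||h|h0 h1|n h n1].
- exact: cycE.
- exact: coinv_cyclic cycE.
- rewrite bar_cycE scale1r /rot_bar.
  (* In degree 0 the rotation has order 1 and is the identity. *)
  by have /= -> := tau_rot_order (alpha (tpure [tuple h])); rewrite alphaK.
- rewrite bar_cycE expr1 scaleN1r; apply: (congr1 (fun z : tpow H 2 => - z)).
  rewrite rot_bar_pure // legmap_pure !big_ord_recl big_ord0 mulr1.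
  rewrite [legs 2 (tau_cyc 1 ord0)]legs1 (tnth_nth 0) /=.
  rewrite (tnth_nth 0) /= [conv (slot 2 1) _]conv1r; last exact: slot_linear.
  have fl : linear (fun y => antipode1 (slot 2 0 h0 * y)).
    exact: lin_comp (@antipode1_linear k H 2) (mul_linearr _).
  rewrite [LHS](linext_comp _ fl (conv_multilinear (slot_linear 2 0) (slot_linear 2 1))).
  apply: eq_linext => u /=.
  have [_ _ slotM] := slot_algmor H 2 0.
  rewrite mulrA -slotM /slot /= tpureM antipode1_pure; congr tpure.
  apply: eq_from_tnth => -[[|[|//]] ilt]; rewrite tnth_mktuple vmulE !tnth_mktuple /=.
    by rewrite mulr1.
  by rewrite mul1r.
by rewrite bar_cycE rot_bar_pure // -sweedler_cyc // !signE.
Qed.
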